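(* Let $\ell\ge5$ be a prime, let $k$ be a positive even integer, let $N$ be a positive integer with $\ell\nmid N$, and let $\psi$ be a Dirichlet character modulo $N$. Assume that $f_1,\dots,f_s\in S_k(N,\psi)$ are normalized eigenforms such that for each $i\in\{1,\dots,s\}$, $\bar\rho_{f_i}(G_{\mathbb{Q}})$ contains a conjugate of $\mathrm{SL}_2(\mathbb{F}_\ell)$. Then for every $\gamma\in\mathrm{SL}_2(\mathbb{F}_\ell)$ there exists $\sigma\in\mathrm{Gal}(\overline{\mathbb{Q}}/\mathbb{Q}(\zeta_\ell))$ such that, for every $i\in\{1,\dots,s\}$, $\bar\rho_{f_i}(\sigma^2)$ is conjugate to $\gamma^2$.
   Context: $G_{\mathbb{Q}}=\mathrm{Gal}(\overline{\mathbb{Q}}/\mathbb{Q})$, and $\zeta_\ell$ is a primitive $\ell$-th root of unity. $S_k(N,\psi)$ is the space of cusp forms of weight $k$ on $\Gamma_0(N)$ with character $\psi$ whose Fourier coefficients are algebraic numbers integral at all primes above $\ell$. A normalized eigenform is a form $f=\sum_{n\ge1}a(n)q^n$ with $a(1)=1$ that is an eigenform of all $T_Q$ ($Q\nmid N$ prime) and $U_Q$ ($Q\mid N$ prime). Fix an embedding $\iota_\ell:\overline{\mathbb{Q}}\hookrightarrow\overline{\mathbb{Q}}_\ell$. For a normalized eigenform $f=\sum a(n)q^n\in S_k(N,\psi)$, $\rho_f:G_{\mathbb{Q}}\to\mathrm{GL}_2(\overline{\mathbb{Q}}_\ell)$ is the unique continuous irreducible representation, unramified at every prime $p\nmid\ell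 N$, such that $\rho_f(\mathrm{Frob}_p)$ (arithmetic Frobenius) has characteristic polynomial $X^2-\iota_\ell(a(p))X+\iota_\ell(\psi(p))p^{k-1}$ for such $p$; $\bar\rho_f:G_{\mathbb{Q}}\to\mathrm{GL}_2(\overline{\mathbb{F}}_\ell)$ is its semisimple mod $\ell$ reduction. Conjugacy of matrices and of subgroups is in $\mathrm{GL}_2(\overline{\mathbb{F}}_\ell)$. *)

(* Defs.v *)
From HB Require Import structures.
From mathcomp Require Import all_boot all_order all_algebra all_field.
From mathcomp Require Import complex.
From mathcomp Require Import all_classical all_reals all_analysis.

Set Implicit Arguments.
Unset Strict Implicit.
Unset Printing Implicit Defensive.

Import Order.TTheory GRing.Theory Num.Theory.
Import numFieldNormedType.Exports.

Local Open Scope classical_set_scope.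
Local Open Scope ring_scope.

(** * The absolute Galois group of the rationals *)

(* [algC] is the field of algebraic numbers.  A ring endomorphism of it fixes
   the rationals and is bijective (see [algC_invaut]), so this type is the
   underlying set of the absolute Galois group of Q; the product of [s] and [t]
   is [s \o t]. *)
Notation GQ := {rmorphism algC -> algC}.

(* A prime ideal, containing the rational prime [p], of the ring [Aint] of all
   algebraic integers. *)
Record prime_above (p : nat) (P : set algC) : Prop := PrimeAbove {
  prime_above_Aint : forall x, P x -> x \in Aint;
  prime_above0 : P 0;
  prime_aboveD : forall x y, P x -> P y -> P (x + y);
  prime_aboveM : forall x y, x \in Aint -> P y -> P (x * y);
  prime_above1 : ~ P 1;
  prime_above_prime : forall x y, x \in Aint -> y \in Aint ->
    P (x * y) -> P x \/ P y;
  prime_above_mem : P p%:R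
}.

(* [x] belongs to the localization of [Aint] at [P], for all [P] above [p]. *)
Definition integral_above (p : nat) (x : algC) : Prop :=
  forall P, prime_above p P ->
    exists s, [/\ s \in Aint, ~ P s & s * x \in Aint].

Definition inertia (P : set algC) (s : GQ) : Prop :=
  forall x, x \in Aint -> P (s x - x).

(* The arithmetic Frobenius elements at [P], [P] being above [p]. *)
Definition arith_frob (p : nat) (P : set algC) (s : GQ) : Prop :=
  forall x, x \in Aint -> P (s x - x ^+ p).

(** * Cusp forms *)

(* The type annotation makes the topology that MathComp-Analysis attaches to a
   [numClosedFieldType] available on the complex numbers. *)
Definition Cplx (R : realType) : numClosedFieldType := (complex R).

Section ModularForms.
Variable R : realType.
Local Notation C := (Cplx R).

Definition cexp (z : C) : C :=
  Complex (expR (complex.Re z) * cos (complex.Im z))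
          (expR (complex.Re z) * sin (complex.Im z)).

Definition upper_half (z : C) : Prop := 0 < complex.Im z.

Definition nome (z : C) : C := cexp (Complex 0 (2 * pi) * z).

Definition dirichlet_character (N : nat) (psi : int -> algC) : Prop :=
  [/\ forall m : int, psi (m + N%:Z) = psi m,
      forall m n : int, psi (m * n) = psi m * psi n
    & forall m : int, (psi m != 0) = coprimez m N%:Z].

Definition automorphy (c d : int) (z : C) : C := c%:~R * z + d%:~R.

Definition mobius (a b c d : int) (z : C) : C :=
  (a%:~R * z + b%:~R) / automorphy c d z.

(* Vanishing at the cusps: every translate of [f] under the weight [k] action
   of the full modular group tends to 0 as the imaginary part of [z] tends to
   infinity. *)
Record cusp_form (k N : nat) (psi : int -> C) (f : C -> C) : Prop :=
  CuspForm {
  cusp_form_holo : forall z, upper_half z -> derivable f z 1;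
  cusp_form_mod : forall a b c d : int, a * d - b * c = 1 -> (N%:Z %| c)%Z ->
    forall z, upper_half z ->
      f (mobius a b c d z) = psi d * automorphy c d z ^+ k * f z;
  cusp_form_cusps : forall a b c d : int, a * d - b * c = 1 ->
    forall e : R, 0 < e -> exists B : R, forall z,
      upper_half z -> B < complex.Im z ->
      complex.Re `|automorphy c d z ^- k * f (mobius a b c d z)| < e
}.

(* [f] is the cusp form with Fourier expansion [\sum_(n >= 1) a n * q ^+ n],
   with algebraic coefficients integral at all primes above [l]; [iota] is the
   inclusion of the algebraic numbers in the complex numbers. *)
Record integral_cusp_form (iota : {rmorphism algC -> C}) (l k N : nat)
    (psi : int -> algC) (f : C -> C) (a : nat -> algC) : Prop :=
  IntegralCuspForm {
  icf_cusp_form : cusp_form k N (fun d => iota (psi d)) f;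
  icf_coef0 : a 0%N = 0;
  icf_expansion : forall z, upper_half z ->
    series (fun n => iota (a n) * nome z ^+ n : C) @ \oo --> f z;
  icf_integral : forall n, integral_above l (a n)
}.

End ModularForms.

(* The actions of [T_Q] (weight [k], character [psi]) and of [U_Q] on
   Fourier coefficients. *)
Definition hecke_T (k : nat) (psi : int -> algC) (Q : nat) (a : nat -> algC)
    (n : nat) : algC :=
  a (Q * n)%N + (if (Q %| n)%N then psi Q%:Z * Q%:R ^+ k.-1 * a (n %/ Q)%N
                 else 0).

Definition hecke_U (Q : nat) (a : nat -> algC) (n : nat) : algC := a (Q * n)%N.

Definition normalized_eigenform (k N : nat) (psi : int -> algC)
    (a : nat -> algC) : Prop :=
  [/\ a 1%N = 1,
      forall Q, prime Q -> ~~ (Q %| N)%N ->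
        exists lam : algC, forall n, hecke_T k psi Q a n = lam * a n
    & forall Q, prime Q -> (Q %| N)%N ->
        exists lam : algC, forall n, hecke_U Q a n = lam * a n].

(** * An algebraic closure of the field of l-adic numbers *)

(* [Ql], embedded in [K] by [inc], is the completion of the rationals for the
   l-adic absolute value, and [K] is an algebraic closure of [Ql], with the
   absolute value [av] extending the l-adic one.  The restriction of [av] to
   the rationals is the l-adic absolute value by [av_l] and the ultrametric
   inequality. *)
Record padic_closure (l : nat) (R : realType) (Ql : fieldType)
    (K : closedFieldType) (inc : {rmorphism Ql -> K}) (av : K -> R) : Prop :=
  PadicClosure {
  av_ge0 : forall x, 0 <= av x;
  av_eq0 : forall x, (av x == 0) = (x == 0);
  avM : forall x y, av (x * y) = av x * av y;
  avD : forall x y, av (x + y) <= Num.max (av x) (av y);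
  av_l : av l%:R = l%:R^-1;
  rat_dense : forall (x : Ql) (e : R), 0 < e ->
    exists r : rat, av (inc x - ratr r) < e;
  Ql_complete : forall u : nat -> Ql,
    (forall e : R, 0 < e -> exists n0, forall m n, (n0 <= m)%N -> (n0 <= n)%N ->
       av (inc (u m) - inc (u n)) < e) ->
    exists x : Ql, forall e : R, 0 < e -> exists n0, forall n, (n0 <= n)%N ->
      av (inc (u n) - inc x) < e;
  K_algebraic : forall x : K, algebraicOver inc x
}.

(* [F], through [red], is the residue field of the valuation ring
   [av x <= 1]; it is an algebraic closure of the field with [l] elements.
   The values of [red] outside of the valuation ring are irrelevant. *)
Record residue_field (R : realType) (K : closedFieldType) (av : K -> R)
    (F : closedFieldType) (red : K -> F) : Prop := ResidueField {
  red1 : red 1 = 1;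
  redD : forall x y, av x <= 1 -> av y <= 1 -> red (x + y) = red x + red y;
  redM : forall x y, av x <= 1 -> av y <= 1 -> red (x * y) = red x * red y;
  red_eq0 : forall x, av x <= 1 -> (red x == 0) = (av x < 1);
  red_surj : forall y, exists2 x, av x <= 1 & red x = y
}.

(** * Two-dimensional representations *)

Definition conjugate (F : fieldType) (A B : 'M[F]_2) : Prop :=
  exists2 g, g \in unitmx & A = g *m B *m invmx g.

Section Representations.
Variable F : fieldType.
Implicit Types r : GQ -> 'M[F]_2.

(* The values of [r] are automatically invertible. *)
Definition representation r : Prop :=
  r idfun = 1%:M /\ forall s t : GQ, r (s \o t) = r s *m r t.

Definition irreducible_rep r : Prop :=
  ~ exists2 v : 'cV[F]_2, v != 0 & forall s, exists c, r s *m v = c *: v.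

Definition upper_tri (x b y : F) : 'M[F]_2 :=
  \matrix_(i, j) if i == 0 then (if j == 0 then x else b)
                 else (if j == 0 then 0 else y).

(* [rss] is a semisimplification of [r]: the direct sum of the Jordan-Hoelder
   constituents of [r], up to conjugacy. *)
Definition semisimplification r rss : Prop :=
  (irreducible_rep r /\
   exists2 g, g \in unitmx & forall s, rss s = g *m r s *m invmx g)
  \/ exists g h : 'M[F]_2, exists chi1 chi2 b : GQ -> F,
     [/\ g \in unitmx, h \in unitmx,
         forall s, r s = g *m upper_tri (chi1 s) (b s) (chi2 s) *m invmx g
       & forall s, rss s = h *m upper_tri (chi1 s) 0 (chi2 s) *m invmx h].

Definition unramified_at (p : nat) r : Prop :=
  forall P, prime_above p P -> forall s, inertia P s -> r s = 1%:M.

(* The embedding in [F], when [F] has characteristic [l]. *)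
Definition Fp_mx (l : nat) (A : 'M['F_l]_2) : 'M[F]_2 :=
  map_mx (fun x : 'F_l => (val x)%:R) A.

Definition contains_conj_SL2 (l : nat) r : Prop :=
  exists2 g, g \in unitmx &
    forall A : 'M['F_l]_2, \det A = 1 ->
      exists s, r s = g *m Fp_mx A *m invmx g.

End Representations.

(* Continuity for the Krull topology on the Galois group and the topology
   defined by [av] on matrices. *)
Definition continuous_rep (R : realType) (K : fieldType) (av : K -> R)
    (rho : GQ -> 'M[K]_2) : Prop :=
  forall (s0 : GQ) (e : R), 0 < e -> exists S : seq algC,
    forall s : GQ, {in S, s =1 s0} -> forall i j, av (rho s i j - rho s0 i j) < e.

(* [rho] is the l-adic representation of the eigenform of weight [k], level [N]
   and character [psi] with Fourier coefficients [a]. *)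
Record attached_rep (R : realType) (K : closedFieldType) (av : K -> R)
    (iotal : {rmorphism algC -> K}) (l k N : nat) (psi : int -> algC)
    (a : nat -> algC) (rho : GQ -> 'M[K]_2) : Prop := AttachedRep {
  att_rep : representation rho;
  att_continuous : continuous_rep av rho;
  att_irreducible : irreducible_rep rho;
  att_unramified : forall p, prime p -> ~~ (p %| l * N)%N ->
    unramified_at p rho;
  att_frob : forall p, prime p -> ~~ (p %| l * N)%N ->
    forall P s, prime_above p P -> arith_frob p P s ->
      char_poly (rho s) =
        'X^2 - (iotal (a p))%:P * 'X + (iotal (psi p%:Z) * p%:R ^+ k.-1)%:P
}.

(* [rhobar] is the semisimplification of the reduction of a conjugate of [rho]
   with entries in the valuation ring; up to conjugacy, it does not depend on
   the choice of this conjugate. *)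
Definition ss_reduction (R : realType) (K : closedFieldType) (av : K -> R)
    (F : closedFieldType) (red : K -> F)
    (rho : GQ -> 'M[K]_2) (rhobar : GQ -> 'M[F]_2) : Prop :=
  exists g : 'M[K]_2,
    [/\ g \in unitmx,
        forall s i j, av ((g *m rho s *m invmx g) i j) <= 1
      & semisimplification (fun s => map_mx red (g *m rho s *m invmx g)) rhobar].

(* Main.v *)
From Pilot Require Import Defs.
From HB Require Import structures.
From mathcomp Require Import all_boot all_order all_algebra all_field.
From mathcomp Require Import complex.
From mathcomp Require Import all_classical all_reals all_analysis.
From mathcomp Require Import all_fingroup all_solvable mxrepresentation mxabelem.
From mathcomp Require Import ring lra.
(* Below, [conjugate] is conjugacy of matrices, not of subsets of a group. *)
Import Pilot.Defs.

Set Implicit Arguments.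
Unset Strict Implicit.
Unset Printing Implicit Defensive.

Import Order.TTheory GRing.Theory Num.Theory.
Local Open Scope ring_scope.

(** The theorem reduces to the study of a finite group with several
    two-dimensional representations whose images are all large.

    By continuity all the [rhobar i] factor through one finite quotient of the
    Galois group, given by its action on a finite set of algebraic numbers that
    contains [zeta] ([finite_galois_quotient], [rhobar_finite]).  SL2 of the
    prime field is perfect for [l >= 5], so a subgroup [G] of this quotient that
    is minimal among those whose images contain given conjugates of it is perfect
    ([perfect_subgroup_SL2]).  As the cyclotomic extension is abelian, [G]
    fixes [zeta], and its images have determinant 1.

    Let [N i] be the subgroup of [G] that acts by scalars through the [i]-th
    representation.  It is a maximal normal subgroup: a normal subgroup [M] of
    [G] either has scalar image or has the same image as [G]
    ([normal_scalar_or_full]).  If [M] has an [l]-element acting nontrivially,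
    this is a Frattini argument.  Otherwise, every element of a coset of [M]
    that contains a nontrivial unipotent is unipotent up to sign; the trace is
    then 2 or -2 on several such cosets, and is affine along them; two opposite
    unipotents together force the matrices of [M] to be diagonal.

    In a perfect group, congruences modulo distinct maximal normal subgroups
    can be solved simultaneously ([comaximal_chinese]).  So there are [U] and
    [W] in [G] that, modulo each [N i], agree with lifts of the standard
    generators of SL2 for an index [j] with [N j = N i].  The standard
    generators satisfy the relations of PSL2(Z), that is, a square, a cube and
    an [l]-th power are scalar.  Membership in [N i] transfers these relations
    from [j] to [i], and they determine the pair up to conjugacy and signs
    ([psl2_pair_standard]).  This elementary rigidity replaces the
    classification of the subgroups of PSL2 and the description of their
    automorphisms.  Therefore a word in the standard generators that is equal
    to [gamma] yields [sigma] with [rhobar i sigma] conjugate to [gamma] or to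
    [- gamma] for all [i], and [sigma \o sigma] is as required. *)

(** * Two-by-two matrices *)

Definition mx2 (F : fieldType) (a b c d : F) : 'M[F]_2 :=
  \matrix_(i, j) if i == 0 then (if j == 0 then a else b)
                 else (if j == 0 then c else d).

Lemma ord2_ind (P : 'I_2 -> Prop) : P 0 -> P 1 -> forall i, P i.
Proof.
move=> P0 P1; case=> [[|[|//]] Hi].
  by congr P: P0; apply/val_inj.
by congr P: P1; apply/val_inj.
Qed.

Lemma matrix2P (F : fieldType) (A B : 'M[F]_2) :
  A 0 0 = B 0 0 -> A 0 1 = B 0 1 -> A 1 0 = B 1 0 -> A 1 1 = B 1 1 -> A = B.
Proof.
by move=> *; apply/matrixP; apply: ord2_ind; apply: ord2_ind.
Qed.

Lemma mx2_eta (F : fieldType) (A : 'M[F]_2) :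
  A = mx2 (A 0 0) (A 0 1) (A 1 0) (A 1 1).
Proof. by apply: matrix2P; rewrite !mxE. Qed.

Lemma mulmx2 (F : fieldType) (a b c d a' b' c' d' : F) :
  mx2 a b c d *m mx2 a' b' c' d' =
  mx2 (a * a' + b * c') (a * b' + b * d') (c * a' + d * c') (c * b' + d * d').
Proof.
by apply: matrix2P; rewrite mxE big_ord_recl big_ord1 !mxE.
Qed.

Lemma det_mx2 (F : fieldType) (a b c d : F) : \det (mx2 a b c d) = a * d - b * c.
Proof.
rewrite (expand_det_row _ 0) big_ord_recl big_ord1 /cofactor !det_mx11 !mxE /=.
by rewrite expr0 expr1 mul1r mulN1r mulrN.
Qed.

Lemma tr_mx2 (F : fieldType) (a b c d : F) : \tr (mx2 a b c d) = a + d.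
Proof. by rewrite /mxtrace big_ord_recl big_ord1 !mxE. Qed.

Lemma mx2_scalar (F : fieldType) (a : F) : a%:M = mx2 a 0 0 a.
Proof. by apply: matrix2P; rewrite !mxE. Qed.

Lemma mx2_inj (F : fieldType) (a b c d a' b' c' d' : F) :
  mx2 a b c d = mx2 a' b' c' d' -> [/\ a = a', b = b', c = c' & d = d'].
Proof.
move/matrixP=> e; have := (e 0 0, e 0 1, (e 1 0, e 1 1)).
by rewrite !mxE /= => -[[-> ->] [-> ->]].
Qed.

Lemma scale_mx2 (F : fieldType) (x a b c d : F) :
  x *: mx2 a b c d = mx2 (x * a) (x * b) (x * c) (x * d).
Proof. by apply: matrix2P; rewrite !mxE. Qed.

Lemma is_scalar_mx2 (F : fieldType) (a b c d : F) :
  is_scalar_mx (mx2 a b c d) = [&& b == 0, c == 0 & a == d].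
Proof.
apply/is_scalar_mxP/and3P => [[e]|[/eqP-> /eqP-> /eqP->]].
  by rewrite mx2_scalar => /mx2_inj[-> -> -> ->].
by exists d; rewrite mx2_scalar.
Qed.

Lemma cayley2 (F : fieldType) (A : 'M[F]_2) :
  \det A = 1 -> A *m A = \tr A *: A - 1%:M.
Proof.
rewrite (mx2_eta A) det_mx2 tr_mx2; move: (A 0 0) (A 0 1) (A 1 0) (A 1 1).
move=> a b c d e; rewrite mulmx2 scale_mx2 mx2_scalar.
by apply: matrix2P; rewrite !mxE /= -?e; ring.
Qed.

Lemma sum_ord2 (V : nmodType) (f : 'I_2 -> V) : \sum_i f i = f 0 + f 1.
Proof.
by rewrite big_ord_recl big_ord1; congr (_ + f _); apply/val_inj.
Qed.

Definition rows2 (F : fieldType) (x y : 'rV[F]_2) : 'M[F]_2 :=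
  mx2 (x 0 0) (x 0 1) (y 0 0) (y 0 1).

Lemma rV2P (F : fieldType) (x y : 'rV[F]_2) :
  x 0 0 = y 0 0 -> x 0 1 = y 0 1 -> x = y.
Proof. by move=> *; apply/rowP; apply: ord2_ind. Qed.

Lemma mul_rows2 (F : fieldType) (x y : 'rV[F]_2) (A : 'M[F]_2) :
  rows2 x y *m A = rows2 (x *m A) (y *m A).
Proof.
by apply: matrix2P; rewrite !mxE !sum_ord2 !mxE.
Qed.

Lemma mul_mx2_rows (F : fieldType) (a b c d : F) (x y : 'rV[F]_2) :
  mx2 a b c d *m rows2 x y = rows2 (a *: x + b *: y) (c *: x + d *: y).
Proof. by rewrite mulmx2 /rows2 !mxE. Qed.

Lemma rows2_unit_or_collinear (F : fieldType) (x y : 'rV[F]_2) :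
  y != 0 -> rows2 x y \in unitmx \/ exists c, x = c *: y.
Proof.
move=> y0; rewrite unitmxE unitfE det_mx2.
case: eqP => [e|]; [right | by left].
have [y00|y00] := eqVneq (y 0 0) 0.
  have y01 : y 0 1 != 0.
    by apply: contraNneq y0 => y01; apply/eqP/rV2P; rewrite mxE.
  exists (x 0 1 / y 0 1); apply: rV2P; rewrite mxE ?divfK //.
  move: e; rewrite y00 !mulr0 subr0 => /eqP.
  by rewrite mulf_eq0 (negPf y01) orbF => /eqP.
exists (x 0 0 / y 0 0); apply: rV2P; rewrite mxE ?divfK //.
apply: (mulIf y00); rewrite mulrAC divfK //.
by apply/esym/eqP; rewrite -subr_eq0; apply/eqP.
Qed.

Lemma fixed_collinear (F : fieldType) (x y : 'rV[F]_2) (A : 'M[F]_2) :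
  y != 0 -> A != 1%:M -> x *m A = x -> y *m A = y -> exists c, x = c *: y.
Proof.
move=> y0 A1 xA yA; case: (rows2_unit_or_collinear x y0) => // U.
case/eqP: A1; apply: (can_inj (mulKmx U)).
by rewrite mul_rows2 xA yA mulmx1.
Qed.

(** A basis whose second vector is [v]: every matrix with eigenvector [v]
    becomes upper triangular in it. *)
Lemma flag_basis (F : fieldType) (v : 'rV[F]_2) : v != 0 ->
  exists2 g, g \in unitmx & forall (A : 'M[F]_2) c, v *m A = c *: v ->
    exists a b, g *m A *m invmx g = mx2 a b 0 c.
Proof.
move=> v0; have [x Ux] : exists x, rows2 x v \in unitmx.
  pose e i : 'rV[F]_2 := delta_mx 0 i.
  case: (rows2_unit_or_collinear (e 0) v0) => [|[a e0]]; first by exists (e 0).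
  case: (rows2_unit_or_collinear (e 1) v0) => [|[b e1]]; first by exists (e 1).
  have := congr1 (fun y : 'rV_2 => y 0 0) e0.
  have := congr1 (fun y : 'rV_2 => y 0 1) e0.
  have := congr1 (fun y : 'rV_2 => y 0 0) e1.
  have := congr1 (fun y : 'rV_2 => y 0 1) e1.
  rewrite !mxE /= => h1 h2 h3 h4.
  have a0 : a != 0.
    by apply: contra_eq_neq h4 => ->; rewrite mul0r oner_eq0.
  move/eqP: h3; rewrite eq_sym mulf_eq0 (negPf a0) /= => /eqP v1.
  by move: h1; rewrite v1 mulr0 => /eqP; rewrite oner_eq0.
exists (rows2 x v) => // A c vA.
set g := rows2 x v in Ux *.
pose y := x *m A *m invmx g.
exists (y 0 0), (y 0 1).
apply: (can_inj (mulmxK Ux)).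
rewrite mulmxKV // mul_mx2_rows mul_rows2 vA scale0r add0r.
congr rows2; apply/esym.
have -> : x *m A = y *m g by rewrite /y mulmxKV.
by apply: rV2P; rewrite ![LHS]mxE ![RHS]mxE sum_ord2 !mxE.
Qed.

Lemma mxtrace_conj (F : fieldType) (g A : 'M[F]_2) : g \in unitmx ->
  \tr (g *m A *m invmx g) = \tr A.
Proof. by move=> Ug; rewrite mxtrace_mulC mulmxA mulVmx // mul1mx. Qed.

Lemma det_conj (F : fieldType) (g A : 'M[F]_2) : g \in unitmx ->
  \det (g *m A *m invmx g) = \det A.
Proof.
by move=> Ug; rewrite !det_mulmx mulrAC -det_mulmx mulmxV // det1 mul1r.
Qed.

Lemma conjM (F : fieldType) (g A B : 'M[F]_2) : g \in unitmx ->
  (g *m A *m invmx g) *m (g *m B *m invmx g) = g *m (A *m B) *m invmx g.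
Proof. by move=> Ug; rewrite !mulmxA mulmxKV. Qed.

Lemma conj_inj (F : fieldType) (g A B : 'M[F]_2) : g \in unitmx ->
  g *m A *m invmx g = g *m B *m invmx g -> A = B.
Proof.
move=> Ug /(can_inj (mulmxKV Ug)) e; exact: (can_inj (mulKmx Ug)) e.
Qed.

Lemma conj_eq1 (F : fieldType) (g A : 'M[F]_2) : g \in unitmx ->
  g *m A *m invmx g = 1%:M -> A = 1%:M.
Proof. by move=> Ug e; apply: (conj_inj Ug); rewrite e mulmx1 mulmxV. Qed.

Lemma scalar_conj (F : fieldType) (g A : 'M[F]_2) : g \in unitmx ->
  is_scalar_mx (g *m A *m invmx g) = is_scalar_mx A.
Proof.
move=> Ug; apply/is_scalar_mxP/is_scalar_mxP => [[c e]|[c ->]]; exists c.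
  by apply: (conj_inj Ug); rewrite e scalar_mxC mulmxK.
by rewrite scalar_mxC mulmxK.
Qed.

(** Both matrices are upper unitriangular in a basis adapted to [v]. *)
Lemma fixed_unipotent_comm (F : fieldType) (v : 'rV[F]_2) (A B : 'M[F]_2) :
  v != 0 -> \det A = 1 -> \det B = 1 -> v *m A = v -> v *m B = v ->
  A *m B = B *m A.
Proof.
move=> v0 dA dB vA vB; have [g Ug gP] := flag_basis v0.
have {}gP C : \det C = 1 -> v *m C = v ->
    exists b, g *m C *m invmx g = mx2 1 b 0 1.
  move=> dC vC; have [|a [b e]] := gP C 1; first by rewrite scale1r.
  have := det_conj C Ug; rewrite e det_mx2 mulr1 mulr0 subr0 dC => a1.
  by exists b; rewrite a1.
have [[a eA] [b eB]] := (gP A dA vA, gP B dB vB).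
apply: (conj_inj Ug); rewrite -!conjM // eA eB !mulmx2.
by apply: matrix2P; rewrite !mxE /=; ring.
Qed.

(** In a basis adapted to [v], [A] is a nontrivial transvection; its
    centralizer consists of the scalar multiples of transvections, and
    determinant 1 forces the scalar to be 1 or -1. *)
Lemma trace_commute_unipotent (F : fieldType) (v : 'rV[F]_2) (A B : 'M[F]_2) :
  v != 0 -> \det A = 1 -> \det B = 1 -> v *m A = v -> A != 1%:M ->
  A *m B = B *m A -> \tr B = 2 \/ \tr B = - 2.
Proof.
move=> v0 dA dB vA A1 AB; have [c vB] : exists c, v *m B = c *: v.
  by apply: (fixed_collinear v0 A1) => //; rewrite -mulmxA -AB mulmxA vA.
have [g Ug gP] := flag_basis v0.
have [|a [b eA]] := gP A 1; first by rewrite scale1r.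
have [a' [b' eB]] := gP B c vB.
have := det_conj A Ug; rewrite eA det_mx2 mulr1 mulr0 subr0 dA => a1.
have := det_conj B Ug; rewrite eB det_mx2 mulr0 subr0 dB => ac.
have b0 : b != 0.
  apply: contraNneq A1 => b0; apply/eqP/(conj_inj Ug).
  by rewrite eA a1 b0 mulmx1 mulmxV // mx2_scalar.
have := congr1 (fun X => g *m X *m invmx g) AB.
rewrite -!conjM // eA eB !mulmx2 a1 => /mx2_inj[_ e _ _].
have {}e : b * (c - a') = 0.
  apply/eqP; rewrite mulrBr subr_eq0 -(inj_eq (addrI b')); apply/eqP.
  by move: e; rewrite !mul1r mulr1 => ->; ring.
move/eqP: e; rewrite mulf_eq0 (negPf b0) /= subr_eq0 => /eqP e.
rewrite -(mxtrace_conj B Ug) eB tr_mx2 -e.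
have : c ^+ 2 == 1 by rewrite expr2 {1}e ac.
by rewrite sqrf_eq1 => /orP[]/eqP->; [left|right]; ring.
Qed.
(** * The generators of the special linear group *)

Definition transvection (F : fieldType) (x : F) : 'M[F]_2 := mx2 1 x 0 1.
Definition weyl (F : fieldType) : 'M[F]_2 := mx2 0 1 (-1) 0.

Lemma transvection_exp (F : fieldType) (n : nat) :
  (transvection 1 : 'M[F]_2) ^+ n = transvection n%:R.
Proof.
elim: n => [|n IH]; first by rewrite expr0 [LHS]mx2_scalar.
rewrite exprS IH [LHS]mulmx2 -[n.+1]addn1 natrD; apply: matrix2P; rewrite !mxE /=; ring.
Qed.

Lemma scalar_affine (F : fieldType) (A : 'M[F]_2) (t c : F) :
  is_scalar_mx (t *: A - c%:M) -> ~~ is_scalar_mx A -> t = 0.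
Proof.
move=> sA; have [//|t0 /negP[]] := eqVneq t 0.
have /is_scalar_mxP[d e] := sA.
apply/is_scalar_mxP; exists (t^-1 * (d + c)).
by rewrite -scale_scalar_mx raddfD /= -e subrK scalerA mulVf // scale1r.
Qed.

Lemma involution_trace0 (F : fieldType) (B : 'M[F]_2) : \det B = 1 ->
  is_scalar_mx (B ^+ 2) -> ~~ is_scalar_mx B -> \tr B = 0.
Proof. by move=> dB; rewrite expr2 [B * B]cayley2 //; apply: scalar_affine. Qed.

(** By Cayley-Hamilton, [C ^+ 3] is [(t ^+ 2 - 1) *: C - t%:M], where [t] is
    the trace of [C]. *)
Lemma order3_trace (F : fieldType) (C : 'M[F]_2) : \det C = 1 ->
  is_scalar_mx (C ^+ 3) -> ~~ is_scalar_mx C -> \tr C ^+ 2 = 1.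
Proof.
move=> dC; have -> : C ^+ 3 = (\tr C ^+ 2 - 1) *: C - (\tr C)%:M.
  rewrite exprS expr2 [C * C]cayley2 // mulrBr mulr1 -scalerAr.
  rewrite [C * C]cayley2 // scalerBr scalerA -expr2 scalerBl scale1r.
  by rewrite scalemx1 addrAC.
by move=> s3 nC; apply/eqP; rewrite -subr_eq0; apply/eqP/(scalar_affine s3).
Qed.

Lemma eigenrow (F : closedFieldType) (A : 'M[F]_2) :
  exists2 v : 'rV_2, v != 0 & exists c, v *m A = c *: v.
Proof.
have [|c] := closed_rootP (char_poly A) _; first by rewrite size_char_poly.
by rewrite -eigenvalue_root_char => /eigenvalueP[v vA v0]; exists v => //; exists c.
Qed.

Lemma eigenrow_exp (F : fieldType) (A : 'M[F]_2) (v : 'rV_2) c n :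
  v *m A = c *: v -> v *m (A ^+ n) = c ^+ n *: v.
Proof.
move=> vA; elim: n => [|n IH]; first by rewrite !expr0 mulmx1 scale1r.
by rewrite exprS [A * _]/(A *m _) mulmxA vA -scalemxAl IH scalerA -exprS.
Qed.

Lemma sqr1_frobenius (F : fieldType) l (c : F) : l \in [pchar F] ->
  c ^+ 2 = 1 -> c ^+ l = c.
Proof.
move=> hl /eqP; rewrite sqrf_eq1 => /orP[] /eqP->; first by rewrite expr1n.
by rewrite -(pFrobenius_autE hl) rmorphN1.
Qed.

(** PSL2(Z) is the free product of a group of order 2, generated by the class
    of [weyl], and a group of order 3, generated by the class of
    [weyl *m transvection 1].  In characteristic [l], a homomorphism from it to
    PGL2(F) that kills neither factor, and kills the [l]-th power of the
    transvection, is thus conjugate to the reduction map.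

    The conjugating basis is explicit.  As [F] has characteristic [l],
    [A] has the eigenvalue [e], 1 or -1, for some row [v]; then [B ^+ 2 = -1],
    and once the sign of [B] is corrected, the rows [- v *m B] and [v] form the
    required basis. *)
Lemma psl2_pair_standard (F : closedFieldType) l (A B : 'M[F]_2) :
  l \in [pchar F] -> \det A = 1 -> \det B = 1 ->
  is_scalar_mx (A ^+ l) -> is_scalar_mx (B ^+ 2) -> is_scalar_mx ((B *m A) ^+ 3) ->
  ~~ is_scalar_mx B -> ~~ is_scalar_mx (B *m A) ->
  exists2 h, h \in unitmx & exists e d : F,
    [/\ e ^+ 2 = 1, d ^+ 2 = 1, A = e *: (h *m transvection 1 *m invmx h)
      & B = d *: (h *m weyl F *m invmx h)].
Proof.
move=> hl dA dB sA sB sC nB nC.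
have BB : B *m B = - 1%:M.
  by rewrite cayley2 // (involution_trace0 dB sB nB) scale0r sub0r.
pose t := \tr (B *m A).
have dC : \det (B *m A) = 1 by rewrite det_mulmx dA dB mulr1.
have t2 : t ^+ 2 = 1 by apply: order3_trace.
have ABA : A *m B *m A = t *: A + B.
  have := congr1 (fun X => - (B *m X)) (cayley2 dC).
  rewrite !mulmxA BB !mulNmx mul1mx opprK => ->.
  by rewrite mulmxBr -scalemxAr mulmxA BB mulNmx mul1mx mulmx1 scalerN opprB opprK addrC.
have [v v0 [e vA]] := eigenrow A.
have e2 : e ^+ 2 = 1.
  have /is_scalar_mxP[c Al] := sA.
  have c2 : c ^+ 2 = 1.
    rewrite -det_scalar -Al.
    by elim: (l) => [|n IH]; rewrite ?expr0 ?det1 // exprS det_mulmx dA mul1r.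
  have el : e ^+ l = c.
    have := eigenrow_exp l vA; rewrite Al mul_mx_scalar => /esym/eqP.
    by rewrite -subr_eq0 -scalerBl scaler_eq0 (negPf v0) orbF subr_eq0 => /eqP.
  suff -> : e = c by [].
  apply: (fmorph_inj (pFrobenius_aut hl)).
  by rewrite /= !pFrobenius_autE el (sqr1_frobenius hl c2).
have ee : e * e = 1 by rewrite -expr2.
(* On [v], the order 3 relation expresses [v *m B *m A] in the basis
   [v *m B], [v]. *)
have vBA : v *m B *m A = t *: v + e *: (v *m B).
  have := congr1 (fun X => e *: (v *m X)) ABA.
  rewrite !mulmxA vA -!scalemxAl scalerA ee scale1r => ->.
  by rewrite mulmxDr -scalemxAr vA scalerDr !scalerA [e * t]mulrC -mulrA ee mulr1.
(* The sign [d] is chosen so that [A] acts on [x] as [e] times the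
   transvection. *)
pose d := - (e * t); pose x := - d *: (v *m B).
have dd : d * d = 1 by rewrite /d mulrNN mulrACA ee -expr2 t2 mulr1.
have d2 : d ^+ 2 = 1 by rewrite expr2.
have t0 : t != 0 by rewrite -sqrf_eq0 t2 oner_eq0.
have dn0 : d != 0 by rewrite -sqrf_eq0 d2 oner_eq0.
have Ug : rows2 x v \in unitmx.
  case: (rows2_unit_or_collinear x v0) => // -[c xv].
  have vB : v *m B = (- d * c) *: v.
    by rewrite -scalerA -xv /x scalerA mulrNN dd scale1r.
  move/eqP: vBA; rewrite vB -scalemxAl vA !scalerA.
  rewrite [e * _]mulrC -subr_eq0 opprD addrCA subrr addr0 oppr_eq0 scaler_eq0.
  by rewrite (negPf t0) (negPf v0).
exists (invmx (rows2 x v)); first by rewrite unitmx_inv.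
exists e, d; rewrite invmxK; split=> //.
  apply: (can_inj (mulKmx Ug)); rewrite -scalemxAr !mulmxA mulmxV // mul1mx.
  rewrite mul_mx2_rows mul_rows2 vA -[X in X *: rows2 _ _]/e.
  rewrite scale_mx2 /rows2.
  have -> : x *m A = e *: (1 *: x + 1 *: v).
    rewrite -scalemxAl vBA scalerDr !scalerA !scale1r scalerDr addrC scalerA.
    by congr (_ *: _ + _ *: _); rewrite /d; [ring | rewrite opprK -mulrA -expr2 t2 mulr1].
  by apply: matrix2P; rewrite !mxE /= ?mul0r ?add0r ?mul1r.
apply: (can_inj (mulKmx Ug)); rewrite -scalemxAr !mulmxA mulmxV // mul1mx.
rewrite mul_mx2_rows mul_rows2 scale_mx2 /rows2.
have -> : x *m B = d *: v.
  by rewrite -scalemxAl -mulmxA BB mulmxN mulmx1 scalerN scaleNr opprK.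
have -> : v *m B = - d *: x by rewrite scalerA mulrNN dd scale1r.
by apply: matrix2P; rewrite !mxE /=; ring.
Qed.

(** The transvections for all entries of the prime field are powers of the
    given one, the lower ones are their conjugates by [weyl], and a matrix with
    nonzero lower left entry is a product of an upper, a lower and an upper
    transvection. *)
Lemma SL2_generation (k : fieldType) (P : 'M[k]_2 -> Prop) :
  (forall x : k, exists n, x = n.+1%:R) ->
  (forall A B, P A -> P B -> P (A *m B)) ->
  P (transvection 1) -> P (weyl k) -> forall A, \det A = 1 -> P A.
Proof.
move=> kn PM Pu Pw.
have PX A n : P A -> P (A ^+ n.+1).
  by move=> PA; elim: n => [|n IH] //; rewrite exprS; apply: PM.
have Pux x : P (transvection x).
  by have [n ->] := kn x; rewrite -transvection_exp; apply: PX.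
have Pvx x : P (mx2 1 0 x 1).
  have -> : mx2 1 0 x 1 = weyl k *m transvection (- x) *m (weyl k ^+ 3).
    have -> : weyl k ^+ 3 = mx2 0 (-1) 1 0.
      rewrite exprS expr2 [weyl k * weyl k]mulmx2 [LHS]mulmx2.
      by apply: matrix2P; rewrite !mxE /=; ring.
    by rewrite !mulmx2; apply: matrix2P; rewrite !mxE /=; ring.
  by apply: (PM); [apply: (PM) | apply: PX].
have Pc A : \det A = 1 -> A 1 0 != 0 -> P A.
  rewrite (mx2_eta A) det_mx2; move: (A 0 0) (A 0 1) (A 1 0) (A 1 1).
  move=> a b c d e; rewrite mxE /= => c0.
  have -> : mx2 a b c d =
      transvection ((a - 1) / c) *m mx2 1 0 c 1 *m transvection ((d - 1) / c).
    rewrite !mulmx2; apply: matrix2P; rewrite !mxE /=; try by field.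
    apply: (mulIf c0); have -> : b * c = a * d - 1 by rewrite -e; ring.
    by field.
  by apply: (PM) => //; apply: PM.
move=> A dA; have [c0|] := eqVneq (A 1 0) 0; last exact: Pc.
have -> : A = mx2 1 0 (-1) 1 *m (mx2 1 0 1 1 *m A).
  rewrite mulmxA mulmx2 -[LHS]mul1mx; congr (_ *m _); rewrite mx2_scalar.
  by apply: matrix2P; rewrite !mxE /=; ring.
apply: (PM) => //; apply: Pc; first by rewrite det_mulmx dA det_mx2; ring.
rewrite {1}(mx2_eta A) mulmx2 mxE /= c0 mul1r mulr0 addr0.
apply/eqP=> a0; have := dA.
by rewrite (mx2_eta A) det_mx2 a0 c0 mulr0 mul0r subr0 => /esym/eqP; rewrite oner_eq0.
Qed.

Section PrimeField.
Variables (F : fieldType) (l : nat).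
Hypothesis hl : l \in [pchar F].
Let pr_l : prime l := pcharf_prime hl.

Let fp (x : 'F_l) : F := (val x)%:R.

Lemma Fp_natr (x : 'F_l) : exists n, x = n.+1%:R.
Proof.
exists (l.-1 + val x)%N; rewrite -addSn prednK ?prime_gt0 //.
by rewrite natrD natr_Zp (pcharf0 (pchar_Fp pr_l)) add0r.
Qed.

Lemma fp_nat n : fp n%:R = n%:R.
Proof. by rewrite /fp /= val_Fp_nat // (GRing.natr_mod_pchar hl). Qed.

Lemma Fp_mxM (A B : 'M['F_l]_2) : Fp_mx F (A *m B) = Fp_mx F A *m Fp_mx F B.
Proof.
have fpD x y : fp (x + y) = fp x + fp y.
  by rewrite -[x in x + y]natr_Zp -[y in _ + y]natr_Zp -natrD fp_nat natrD.
have fpM x y : fp (x * y) = fp x * fp y.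
  by rewrite -[x in x * y]natr_Zp -[y in _ * y]natr_Zp -natrM fp_nat natrM.
apply/matrixP=> i j; rewrite !mxE !sum_ord2 !mxE.
by rewrite -/(fp _) fpD !fpM.
Qed.

Lemma Fp_mx_nat (a b c d : nat) :
  Fp_mx F (mx2 a%:R b%:R c%:R d%:R : 'M['F_l]_2) = mx2 a%:R b%:R c%:R d%:R.
Proof. by apply: matrix2P; rewrite !mxE -/(fp _) fp_nat. Qed.

Lemma natr_predl (R : nzRingType) : l \in [pchar R] -> l.-1%:R = -1 :> R.
Proof.
move=> hR; apply/eqP; rewrite -subr_eq0 opprK natr1 prednK ?prime_gt0 //.
by rewrite (pcharf0 hR).
Qed.

Lemma Fp_mx_transvection : Fp_mx F (transvection (1 : 'F_l)) = transvection 1.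
Proof. exact: (Fp_mx_nat 1 1 0 1). Qed.

Lemma Fp_mx_weyl : Fp_mx F (weyl 'F_l) = weyl F.
Proof.
have := Fp_mx_nat 0 1 l.-1 0.
by rewrite !natr_predl // pchar_Fp.
Qed.

End PrimeField.
(** * Normal subgroups of a perfect group with large image *)

Lemma der1_ind (gT : finGroupType) (G : {group gT}) (P : gT -> Prop) :
  P 1%g ->
  (forall x y, x \in G -> y \in G -> P x -> P y -> P (x * y)%g) ->
  (forall x y, x \in G -> y \in G -> P [~ x, y]%g) ->
  forall x, x \in G^`(1)%g -> P x.
Proof.
move=> P1 PM PR x; rewrite derg1 => /gen_prodgP[n [c cP ->]].
have {}cP i : c i \in G /\ P (c i).
  have /imset2P[y z Gy Gz ->] := cP i.
  by split; [apply: groupR | apply: PR].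
suff [] : (\prod_i c i)%g \in G /\ P (\prod_i c i)%g by [].
elim/big_ind: _ => // y z [Gy Py] [Gz Pz].
by split; [apply: groupM | apply: PM].
Qed.

Section Representation.
Variables (gT : finGroupType) (G : {group gT}) (F : fieldType) (l : nat).
Variable rG : mx_representation F G 2.
Hypothesis hl : l \in [pchar F].

Lemma repr_conj_exp (g A : 'M[F]_2) x n : g \in unitmx -> x \in G ->
  rG x = g *m A *m invmx g -> rG (x ^+ n)%g = g *m (A ^+ n) *m invmx g.
Proof.
move=> Ug Gx xA; elim: n => [|n IH].
  by rewrite expg0 repr_mx1 expr0 mulmx1 mulmxV.
by rewrite expgS repr_mxM ?groupX // xA IH conjM // exprS.
Qed.

Lemma repr_commg x y : x \in G -> y \in G -> rG x *m rG y = rG y *m rG x ->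
  rG [~ x, y]%g = 1%:M.
Proof.
move=> Gx Gy xy; have -> : [~ x, y]%g = ((y * x)^-1 * (x * y))%g.
  by rewrite commgEl conjgE invMg !mulgA.
rewrite repr_mxM ?groupV ?groupM // repr_mxV ?groupM // !repr_mxM // xy.
by rewrite mulVmx // -repr_mxM // repr_mx_unit // groupM.
Qed.

Lemma repr_commg_scalar x y (v : 'rV[F]_2) (c d : F) : v != 0 ->
  x \in G -> y \in G -> v *m rG x = c *: v -> v *m rG y = d *: v ->
  v *m rG [~ x, y]%g = v.
Proof.
move=> v0 Gx Gy vx vy.
have inv z a : z \in G -> v *m rG z = a *: v ->
    a != 0 /\ v *m rG z^-1%g = a^-1 *: v.
  move=> Gz vz; have e : v = a *: (v *m rG z^-1%g).
    by rewrite scalemxAl -vz -mulmxA -repr_mxM ?groupV // mulgV repr_mx1 mulmx1.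
  have a0 : a != 0 by apply: contraNneq v0 => a0; rewrite e a0 scale0r.
  by split=> //; rewrite [X in _ = _ *: X]e scalerA mulVf // scale1r.
have [c0 vx'] := inv x c Gx vx; have [d0 vy'] := inv y d Gy vy.
rewrite commgEl conjgE !repr_mxM ?groupM ?groupV //.
rewrite !mulmxA vx' -!scalemxAl vy' -!scalemxAl vx -!scalemxAl vy !scalerA.
by rewrite (_ : _ * _ = 1) ?scale1r //; field; apply/andP.
Qed.

Lemma perfect_det1 x : G^`(1)%g = G -> x \in G -> \det (rG x) = 1.
Proof.
move=> perfG; rewrite -{1}perfG; move: x; apply: der1_ind.
- by rewrite repr_mx1 det1.
- by move=> x y Gx Gy dx dy; rewrite repr_mxM // det_mulmx dx dy mulr1.
move=> x y Gx Gy; rewrite commgEl conjgE !repr_mxM ?groupM ?groupV //.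
rewrite !det_mulmx !repr_mxV // !det_inv; field.
by rewrite -!unitfE -!unitmxE !repr_mx_unit.
Qed.

Lemma pgroup_fixed_row (Q : {group gT}) : (l.-group Q)%g -> Q \subset G ->
  exists2 v : 'rV[F]_2, v != 0 & forall x, x \in Q -> v *m rG x = v.
Proof.
move=> lQ sQG; have /rowV0Pn[v] := rfix_pgroup_pchar hl rG (ltn0Sn 1) lQ sQG.
by move/rfix_mxP=> vQ v0; exists v.
Qed.

(** The exponent is the order of the [l']-part of [y]. *)
Lemma exists_coprime_kernel_exp y : y \in G -> rG (y.`_l)%g = 1%:M ->
  exists2 k, ~~ (l %| k)%N & rG (y ^+ k)%g = 1%:M.
Proof.
move=> Gy yl; have pr_l := pcharf_prime hl.
exists #[y.`_l^']%g; first by rewrite -p'natE //; apply: p_elt_constt.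
have Gc pi : (y.`_pi)%g \in G by rewrite groupX.
rewrite -{1}(consttC l y) expgMn; last exact: commuteX2.
by rewrite expg_order mulg1 repr_mxX // yl expr1n.
Qed.

(** An element whose order in the image is divisible by [l] has a nontrivial
    unipotent power, with which it commutes; hence it is unipotent up to
    sign. *)
Lemma kernel_exp_or_trace y : G^`(1)%g = G -> y \in G ->
  (exists2 k, ~~ (l %| k)%N & rG (y ^+ k)%g = 1%:M) \/
  (\tr (rG y) = 2 \/ \tr (rG y) = - 2).
Proof.
move=> perfG Gy; have [yl|yl] := eqVneq (rG (y.`_l)%g) 1%:M.
  by left; apply: exists_coprime_kernel_exp.
right; have Gyl : (y.`_l)%g \in G by rewrite groupX.
have [||v v0 vP] := @pgroup_fixed_row <[y.`_l]>%G; first exact: p_elt_constt.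
  by rewrite cycle_subG.
apply: (trace_commute_unipotent v0 _ _ _ yl); rewrite ?perfect_det1 //.
  by apply: vP; apply: cycle_id.
by rewrite -!repr_mxM //; congr (rG _); apply: commute_sym; apply: commuteX.
Qed.

Section NormalSubgroup.
Variable M : {group gT}.
Hypotheses (perfG : G^`(1)%g = G) (nMG : normal M G).
Let sMG : M \subset G. Proof. exact: normal_sub. Qed.

(** Frattini argument.  Let [Q] be a Sylow [l]-subgroup of [M] containing [x].
    The image of [Q] is a nontrivial unipotent group, so it fixes just one
    line, which the normalizer [N] of [Q] preserves; therefore the image of [N]
    is triangular and the second derived subgroup of [N] acts trivially.
    As [G = M * N] is perfect, [G] is [M * N^`(2)]. *)
Lemma normal_with_pelement_full x : x \in M -> (l.-elt x)%g -> rG x != 1%:M ->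
  G \subset (M * rker rG)%g.
Proof.
move=> Mx lx x1.
have [||Q sylQ] := @Sylow_superset l _ M <[x]>%G; rewrite ?cycle_subG // => Qx.
have lQ := pHall_pgroup sylQ.
have sQG : Q \subset G by apply: fintype.subset_trans (pHall_sub sylQ) sMG.
have [v v0 vQ] := pgroup_fixed_row lQ sQG.
pose N := 'N_G(Q)%G; have sNG : N \subset G by apply: finset.subsetIl.
have vN n : n \in N -> exists c, v *m rG n = c *: v.
  case/setIP=> Gn nQ; apply: (fixed_collinear v0 x1); last exact: vQ.
  have Qxn : (x ^ n^-1)%g \in Q by rewrite memJ_norm ?groupV.
  have Gx := fintype.subsetP sMG x Mx.
  rewrite -mulmxA -repr_mxM // (_ : n * x = x ^ n^-1 * n)%g.
    by rewrite repr_mxM ?(fintype.subsetP sQG _ Qxn) // mulmxA vQ.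
  by rewrite conjgE invgK mulgA mulgKV.
have N1G : N^`(1)%g \subset G by apply: fintype.subset_trans (der_sub 1 N) sNG.
have vN1 n : n \in N^`(1)%g -> v *m rG n = v.
  move: n; apply: der1_ind.
  - by rewrite repr_mx1 mulmx1.
  - by move=> y z Ny Nz vy vz; rewrite repr_mxM ?(fintype.subsetP sNG) // mulmxA vy.
  move=> y z Ny Nz; have [[c vy] [d vz]] := (vN y Ny, vN z Nz).
  have [Gy Gz] := (fintype.subsetP sNG y Ny, fintype.subsetP sNG z Nz).
  exact: (repr_commg_scalar v0 Gy Gz vy vz).
have N2 : N^`(2)%g \subset rker rG.
  apply/fintype.subsetP; apply: (@der1_ind _ (N^`(1))%G).
  - exact: group1.
  - by move=> y z _ _; apply: groupM.
  move=> y z Ny Nz; have [Gy Gz] := (fintype.subsetP N1G y Ny, fintype.subsetP N1G z Nz).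
  apply/rkerP; split; first exact: groupR.
  apply: repr_commg => //; apply: (fixed_unipotent_comm v0);
    by rewrite ?perfect_det1 ?vN1.
have nMN : N \subset 'N(M)%g := fintype.subset_trans sNG (normal_norm nMG).
have GN : (G / M = N / M)%g.
  rewrite -{1}(Frattini_arg nMG sylQ) quotientMl ?normG // trivg_quotient mul1g.
  by [].
have perfG2 : G^`(2)%g = G by rewrite dergSn perfG -[RHS]perfG derg1.
have : (G / M \subset rker rG / M)%g.
  rewrite -{1}perfG2 quotient_der ?normal_norm // GN -quotient_der //.
  exact: quotientS.
by rewrite quotientSK // normal_norm.
Qed.

(** The key point when [M] acts through a group of order prime to [l].  A
    power of [m * X ^+ t] lies in the coset of the same power of [X ^+ t];
    if a power of exponent prime to [l] acted trivially, a power of [X] of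
    exponent prime to [l] would act as an element of [M], and so would have
    order prime to [l] in the image, contrary to the hypothesis on [X]. *)
Lemma trace_normal_mul (m X : gT) t : m \in M -> X \in G ->
  (forall x, x \in M -> (l.-elt x)%g -> rG x = 1%:M) ->
  (forall n, rG (X ^+ n)%g = 1%:M -> (l %| n)%N) -> ~~ (l %| t)%N ->
  \tr (rG (m * X ^+ t)%g) = 2 \/ \tr (rG (m * X ^+ t)%g) = - 2.
Proof.
move=> Mm GX M1 X1 lt; have pr_l := pcharf_prime hl.
have Gm := fintype.subsetP sMG m Mm.
have GmX : (m * X ^+ t)%g \in G by rewrite groupM ?groupX.
have [[k lk yk]|//] := kernel_exp_or_trace perfG GmX.
have nM z : z \in G -> z \in 'N(M)%g.
  exact: (fintype.subsetP (normal_norm nMG)).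
have /rcoset_kercosetP : coset M ((m * X ^+ t) ^+ k)%g = coset M (X ^+ (t * k))%g.
  rewrite morphX ?nM //= morphM ?nM ?groupX //= (coset_id Mm) mul1g.
  by rewrite -morphX ?nM ?groupX // -expgM.
rewrite !nM ?groupX // => /(_ isT isT) /rcosetP[m1 Mm1 e].
have Gm1 := fintype.subsetP sMG m1 Mm1.
have [k1 lk1 mk1] := exists_coprime_kernel_exp Gm1
  (M1 _ (groupX _ Mm1) (p_elt_constt _ _)).
have rm1 : rG m1 = rG (X ^- (t * k))%g.
  rewrite -[m1](mulgK (X ^+ (t * k))%g) -e repr_mxM ?groupV ?groupX //.
  by rewrite yk mul1mx.
have : (l %| t * k * k1)%N.
  apply: X1; rewrite expgM -[(X ^+ (t * k))%g]invgK expgVn.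
  rewrite repr_mxV ?groupX ?groupV ?groupX // repr_mxX ?groupV ?groupX //.
  by rewrite -rm1 -repr_mxX // mk1 invmx1.
by rewrite !Euclid_dvdM // (negPf lt) (negPf lk) (negPf lk1).
Qed.

Hypothesis l5 : (5 <= l)%N.

Lemma transvection_order n : transvection 1 ^+ n = 1 :> 'M[F]_2 -> (l %| n)%N.
Proof.
rewrite transvection_exp => /matrixP/(_ 0 1); rewrite !mxE /= => /eqP.
by rewrite (dvdn_pcharf hl).
Qed.

Lemma small_natr_neq0 n : (0 < n < 5)%N -> n%:R != 0 :> F.
Proof.
case/andP=> n0 n5; rewrite -(dvdn_pcharf hl); apply/negP=> /(dvdn_leq n0).
by rewrite leqNgt (leq_trans n5).
Qed.

(** Among three consecutive terms of the progression two are equal, and the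
    integers 1 and 2 are invertible. *)
Lemma pm2_progression (s c : F) :
  (forall t, (0 < t < 5)%N -> s + c * t%:R = 2 \/ s + c * t%:R = - 2) -> c = 0.
Proof.
move=> H; have n2 : 2 != 0 :> F by apply: (@small_natr_neq0 2).
have c1 t : (0 < t < 4)%N -> s + c * t%:R = s + c * t.+1%:R -> c = 0.
  rewrite -natr1 mulrDr mulr1 addrA => _ /eqP.
  by rewrite -{1}[s + _]addr0 (inj_eq (addrI _)) eq_sym => /eqP.
have [e1|e1] := H 1%N isT; have [e2|e2] := H 2%N isT.
- by apply: (c1 1%N) => //; rewrite e1 e2.
- have [e3|e3] := H 3%N isT; last by apply: (c1 2%N) => //; rewrite e2 e3.
  apply: (mulIf n2); apply: (addrI (s + c)).
  by rewrite mul0r addr0; transitivity (s + c * 3%:R); [ring | rewrite e3 -e1; ring].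
- have [e3|e3] := H 3%N isT; first by apply: (c1 2%N) => //; rewrite e2 e3.
  apply: (mulIf n2); apply: (addrI (s + c)).
  by rewrite mul0r addr0; transitivity (s + c * 3%:R); [ring | rewrite e3 -e1; ring].
- by apply: (c1 1%N) => //; rewrite e1 e2.
Qed.

(** If [M] has no [l]-element acting nontrivially, take [m] in [M], with
    matrix of entries [a b c d] in the basis given by [g].  The trace of
    [m * U ^+ t] is [a + d + c * t], which is 2 or -2 for [t = 1, 2, 3] by
    [trace_normal_mul]; hence [c = 0], and [b = 0] by the same argument
    with [V].  So [M] is diagonal, and since [U] normalizes it, scalar. *)
Lemma normal_scalar_or_full (g : 'M[F]_2) U V : g \in unitmx ->
  U \in G -> V \in G -> rG U = g *m transvection 1 *m invmx g ->
  rG V = g *m mx2 1 0 1 1 *m invmx g ->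
  M \subset rcenter rG \/ G \subset (M * rker rG)%g.
Proof.
move=> Ug GU GV rU rV.
have [/existsP[x /and3P[Mx lx x1]]|] :=
    boolP [exists x, [&& x \in M, (l.-elt x)%g & rG x != 1%:M]].
  by right; apply: (normal_with_pelement_full Mx).
rewrite negb_exists => /forallP noM; left.
have {}noM x : x \in M -> (l.-elt x)%g -> rG x = 1%:M.
  by move=> Mx lx; have := noM x; rewrite Mx lx negbK => /eqP.
have lowerX n : mx2 1 0 1 1 ^+ n = mx2 1 0 n%:R (1 : F).
  elim: n => [|n IH]; first by rewrite expr0 [LHS]mx2_scalar.
  rewrite exprS IH [LHS]mulmx2 -[n.+1]addn1 natrD.
  by apply: matrix2P; rewrite !mxE /=; ring.
have U1 n : rG (U ^+ n)%g = 1%:M -> (l %| n)%N.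
  by rewrite (repr_conj_exp n Ug GU rU) => /(conj_eq1 Ug)/transvection_order.
have V1 n : rG (V ^+ n)%g = 1%:M -> (l %| n)%N.
  rewrite (repr_conj_exp n Ug GV rV) => /(conj_eq1 Ug).
  rewrite lowerX mx2_scalar => /mx2_inj[_ _ /eqP + _].
  by rewrite (dvdn_pcharf hl).
have lt t : (0 < t < 5)%N -> ~~ (l %| t)%N.
  by move=> t5; rewrite (dvdn_pcharf hl) small_natr_neq0.
have diag m : m \in M -> exists a d, rG m = g *m mx2 a 0 0 d *m invmx g.
  move=> Mm; have Gm := fintype.subsetP sMG m Mm.
  pose A := invmx g *m rG m *m g.
  have rm : rG m = g *m A *m invmx g by rewrite /A !mulmxA mulmxV // mul1mx mulmxK.
  exists (A 0 0), (A 1 1); rewrite rm {1}(mx2_eta A); do 2![congr (_ *m _)].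
  congr mx2.
    apply: (@pm2_progression (\tr A)) => t t5.
    have := trace_normal_mul Mm GV noM V1 (lt t t5).
    rewrite repr_mxM ?groupX // rm (repr_conj_exp t Ug GV rV) conjM // mxtrace_conj //.
    rewrite lowerX (mx2_eta A) mulmx2 !tr_mx2 !mxE /=.
    by rewrite !mulr1 mulr0 add0r addrAC.
  apply: (@pm2_progression (\tr A)) => t t5.
  have := trace_normal_mul Mm GU noM U1 (lt t t5).
  rewrite repr_mxM ?groupX // rm (repr_conj_exp t Ug GU rU) conjM // mxtrace_conj //.
  rewrite transvection_exp (mx2_eta A) mulmx2 !tr_mx2 !mxE /=.
  by rewrite !mulr1 mulr0 addr0 [_ * t%:R + _]addrC addrA.
apply/fintype.subsetP=> m Mm; have Gm := fintype.subsetP sMG m Mm.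
rewrite inE Gm; have [a [d rm]] := diag m Mm.
have MmU : (m ^ U^-1)%g \in M.
  by rewrite memJ_norm // groupV (fintype.subsetP (normal_norm nMG)).
have [a' [d' rmU]] := diag _ MmU.
have : rG (m ^ U^-1)%g *m rG U = rG U *m rG m.
  by rewrite -!repr_mxM ?(fintype.subsetP sMG (m ^ _)%g) // conjgE invgK !mulgA mulgKV.
rewrite rmU rU rm !conjM // => /(conj_inj Ug).
rewrite !mulmx2 => /mx2_inj[].
rewrite !mulr0 !mulr1 !mul0r !mul1r !addr0 !add0r => <- <- _ _.
by rewrite scalar_conj // is_scalar_mx2 !eqxx.
Qed.

End NormalSubgroup.
End Representation.
(** * A Chinese remainder theorem for perfect groups *)

(** The maximal proper normal subgroups, with maximality put in the form in
    which it is proved and used. *)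
Record comaximal_normal (gT : finGroupType) (G N : {group gT}) : Prop :=
  ComaximalNormal {
  cn_normal : normal N G;
  cn_proper : ~~ (G \subset N);
  cn_max : forall M : {group gT}, normal M G ->
    M \subset N \/ G \subset (N * M)%g
}.

Section ChineseRemainder.
Variables (gT : finGroupType) (G : {group gT}).
Hypothesis perfG : G^`(1)%g = G.

Lemma comaximal_sub_eq (N N' : {group gT}) : comaximal_normal G N ->
  comaximal_normal G N' -> N' \subset N -> N' = N.
Proof.
move=> cN cN' sN'N; apply/val_inj/eqP; rewrite finset.eqEsubset sN'N /=.
have [//|] := cn_max cN' (cn_normal cN).
rewrite mulSGid // => sGN; case/negP: (cn_proper cN).
by [].
Qed.

(** If neither [A] nor [B] is contained in [N], both map onto [G / N], so
    [G / N], being perfect, is the image of [[~: A, B]], which lies in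
    [A :&: B]. *)
Lemma comaximal_prime (N A B : {group gT}) : comaximal_normal G N ->
  normal A G -> normal B G -> A :&: B \subset N -> A \subset N \/ B \subset N.
Proof.
move=> cN nA nB sABN; have nN := normal_norm (cn_normal cN).
have [|GA] := cn_max cN nA; first by left.
have [|GB] := cn_max cN nB; first by right.
case/negP: (cn_proper cN).
have [sAG sBG] := (normal_sub nA, normal_sub nB).
have [nAN nBN] := (fintype.subset_trans sAG nN, fintype.subset_trans sBG nN).
rewrite -quotient_sub1 // -perfG derg1 quotientR //.
apply: (@fintype.subset_trans _ _ (mem [~: A / N, B / N]%g)).
  by apply: commgSS; rewrite quotientSK.
rewrite -quotientR // quotient_sub1; last by rewrite comm_subG.
apply: fintype.subset_trans sABN; rewrite finset.subsetI commg_subl commg_subr.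
rewrite (fintype.subset_trans sBG (normal_norm nA)).
by rewrite (fintype.subset_trans sAG (normal_norm nB)).
Qed.

(** The group [K] is the intersection of the members of [L], and
    [comaximal_prime] says that it is not contained in [N]. *)
Lemma comaximal_avoid (N : {group gT}) (L : seq {group gT}) :
  comaximal_normal G N -> (forall M, M \in L -> comaximal_normal G M) ->
  N \notin L ->
  exists K : {group gT}, [/\ normal K G, forall M, M \in L -> K \subset M
    & G \subset (N * K)%g].
Proof.
move=> cN; elim: L => [|M L IH] cL.
  by exists G; split=> //; apply: mulG_subr.
rewrite inE negb_or => /andP[NM NL].
have cM : comaximal_normal G M by apply: cL; rewrite mem_head.
have {}cL H : H \in L -> comaximal_normal G H.
  by move=> HL; apply: cL; rewrite inE HL orbT.
have [K [nK KL GK]] := IH cL NL.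
exists (K :&: M)%G; split.
- exact: normalI (cn_normal cM).
- move=> H; rewrite inE => /orP[/eqP->|/KL]; first exact: finset.subsetIr.
  by apply: fintype.subset_trans; apply: finset.subsetIl.
have [|//] := cn_max cN (normalI nK (cn_normal cM)).
case/(comaximal_prime cN nK (cn_normal cM)) => [sKN|sMN].
  by case/negP: (cn_proper cN); apply: (fintype.subset_trans GK); rewrite mulGSid.
by case/eqP: NM; rewrite (comaximal_sub_eq cN cM sMN).
Qed.

(** A solution modulo the members of the tail is corrected by an element of the
    group given by [comaximal_avoid]. *)
Lemma comaximal_chinese (L : seq {group gT}) (f : {group gT} -> gT) : uniq L ->
  (forall N, N \in L -> comaximal_normal G N) -> (forall N, f N \in G) ->
  exists2 x, x \in G & forall N, N \in L -> x \in (N :* f N)%g.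
Proof.
move=> + + fG; elim: L => [|N L IH] /=; first by exists 1%g.
case/andP=> NL uL cL; have cN : comaximal_normal G N by apply: cL; rewrite mem_head.
have {}cL M : M \in L -> comaximal_normal G M.
  by move=> ML; apply: cL; rewrite inE ML orbT.
have [x Gx xL] := IH uL cL.
have [K [nK KL GK]] := comaximal_avoid cN cL NL.
have /mulsgP[n k Nn Kk e] : (f N * x^-1)%g \in (N * K)%g.
  by rewrite (fintype.subsetP GK) // groupM ?groupV.
exists (k * x)%g; first by rewrite groupM // (fintype.subsetP (normal_sub nK)).
move=> M; rewrite inE => /orP[/eqP->|ML].
  rewrite mem_rcoset (_ : k * x * (f N)^-1 = n^-1)%g ?groupV //.
  apply/eqP; rewrite eq_sym -(inj_eq invg_inj) invgK !invMg invgK.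
  by rewrite mulgA e mulgK.
have /rcosetP[m Mm ->] := xL M ML.
apply/rcosetP; exists (k * m)%g; rewrite ?mulgA // groupM //.
exact: (fintype.subsetP (KL M ML)).
Qed.

End ChineseRemainder.

(** * Simultaneous conjugacy *)

(** The equation says that [C] is the commutator of [A] and [B], without
    inverses. *)
Lemma repr_commg_conj (gT : finGroupType) (G : {group gT}) (F : fieldType)
    (rG : mx_representation F G 2) (g A B C : 'M[F]_2) x y :
  g \in unitmx -> x \in G -> y \in G ->
  rG x = g *m A *m invmx g -> rG y = g *m B *m invmx g ->
  B *m A *m C = A *m B -> rG [~ x, y]%g = g *m C *m invmx g.
Proof.
move=> Ug Gx Gy rx ry e; have Gyx : (y * x)%g \in G by rewrite groupM.
apply: (can_inj (mulKmx (repr_mx_unit rG Gyx))).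
rewrite -repr_mxM ?groupR // (_ : y * x * [~ x, y] = x * y)%g.
  by rewrite !repr_mxM // rx ry !conjM // e.
by rewrite commgEl conjgE !mulgA mulgK mulgV mul1g.
Qed.

Section SimultaneousImage.
Variables (gT : finGroupType) (F : closedFieldType) (l : nat) (I : finType).
Hypotheses (hl : l \in [pchar F]) (l5 : (5 <= l)%N).
Variable g : I -> 'M[F]_2.
Hypothesis Ug : forall i, g i \in unitmx.

(** A subgroup minimal for the property of having all these images is perfect:
    SL2 of the prime field is perfect, since its standard generators are
    products of commutators with the diagonal matrix of entries 2 and 1/2, so
    the derived subgroup has the property too.  This uses that 2 and 3 are
    invertible. *)
Lemma perfect_subgroup_SL2 (G : {group gT}) (r : I -> mx_representation F G 2) :
  (forall i (A : 'M['F_l]_2), \det A = 1 ->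
    exists2 x, x \in G & r i x = g i *m Fp_mx F A *m invmx (g i)) ->
  exists H : {group gT}, [/\ H \subset G, H^`(1)%g = H
    & forall i (A : 'M['F_l]_2), \det A = 1 ->
      exists2 x, x \in H & r i x = g i *m Fp_mx F A *m invmx (g i)].
Proof.
move=> rSL; have pr_l := pcharf_prime hl.
pose P (H : {group gT}) := `[< forall i (A : 'M['F_l]_2), \det A = 1 ->
  exists2 x, x \in H & r i x = g i *m Fp_mx F A *m invmx (g i) >].
have PG : P G by apply/asboolP.
have [H minH sHG] := mingroup_exists PG.
have {minH} [/asboolP HP minH] := mingroupP minH.
exists H; split=> //.
apply: (minH (H^`(1))%G); last exact: der_sub.
apply/asboolP=> i.
have n2 : 2 != 0 :> 'F_l.
  by apply: (small_natr_neq0 (pchar_Fp pr_l) l5 (n := 2)).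
have n3 : 3 != 0 :> 'F_l.
  by apply: (small_natr_neq0 (pchar_Fp pr_l) l5 (n := 3)).
have subHG := fintype.subsetP sHG.
have comm (A B C : 'M['F_l]_2) : \det A = 1 -> \det B = 1 ->
    B *m A *m C = A *m B ->
    exists2 x, x \in H^`(1)%g & r i x = g i *m Fp_mx F C *m invmx (g i).
  move=> dA dB e; have [[x Hx rx] [y Hy ry]] := (HP i A dA, HP i B dB).
  exists [~ x, y]%g; first by rewrite derg1 mem_commg.
  apply: (repr_commg_conj (Ug i) (subHG x Hx) (subHG y Hy) rx ry).
  by rewrite -!Fp_mxM // e.
have PM (A B : 'M['F_l]_2) :
    (exists2 x, x \in H^`(1)%g & r i x = g i *m Fp_mx F A *m invmx (g i)) ->
    (exists2 x, x \in H^`(1)%g & r i x = g i *m Fp_mx F B *m invmx (g i)) ->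
    exists2 x, x \in H^`(1)%g & r i x = g i *m Fp_mx F (A *m B) *m invmx (g i).
  have sub1 := fintype.subsetP (fintype.subset_trans (der_sub 1 H) sHG).
  move=> [x Hx rx] [y Hy ry]; exists (x * y)%g; first exact: groupM.
  by rewrite repr_mxM ?sub1 // rx ry conjM // Fp_mxM.
have Pu : exists2 x, x \in H^`(1)%g &
    r i x = g i *m Fp_mx F (transvection (1 : 'F_l)) *m invmx (g i).
  (* The commutator of this diagonal matrix with [transvection y] is
     [transvection (y - y / 4)]. *)
  apply: (comm (mx2 2 0 0 2^-1) (transvection (4 / 3)) (transvection 1)).
  - by rewrite det_mx2; field.
  - by rewrite det_mx2; ring.
  by rewrite !mulmx2; apply: matrix2P; rewrite !mxE /=; field; rewrite ?n2 ?n3.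
apply: (SL2_generation _ PM Pu); first exact: Fp_natr (pchar_Fp pr_l).
have -> : weyl 'F_l = transvection 1 *m mx2 1 0 (-1) 1 *m transvection 1.
  by rewrite !mulmx2; apply: matrix2P; rewrite !mxE /=; ring.
apply: (PM) => //; apply: (PM) => //.
apply: (comm (mx2 2 0 0 2^-1) (mx2 1 0 (1 / 3) 1)).
- by rewrite det_mx2; field.
- by rewrite det_mx2; ring.
by rewrite !mulmx2; apply: matrix2P; rewrite !mxE /=; field; rewrite ?n2 ?n3.
Qed.

Section Perfect.
Variables (G : {group gT}) (r : I -> mx_representation F G 2).
Hypothesis perfG : G^`(1)%g = G.
Hypothesis rSL : forall i (A : 'M['F_l]_2), \det A = 1 ->
  exists2 x, x \in G & r i x = g i *m Fp_mx F A *m invmx (g i).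

Let N i : {group gT} := [group of rcenter (r i)].

Lemma mem_rcenter i x : x \in G -> (x \in N i) = is_scalar_mx (r i x).
Proof. by move=> Gx; rewrite inE Gx. Qed.

Lemma transvection_nonscalar : ~~ is_scalar_mx (transvection 1 : 'M[F]_2).
Proof. by rewrite is_scalar_mx2 oner_eq0. Qed.

Lemma weyl_nonscalar : ~~ is_scalar_mx (weyl F).
Proof. by rewrite is_scalar_mx2 oner_eq0. Qed.

Lemma rcenter_comaximal i : comaximal_normal G (N i).
Proof.
have pr_l := pcharf_prime hl.
have [|U GU] := rSL i (A := transvection 1); first by rewrite det_mx2; ring.
rewrite Fp_mx_transvection // => rU.
have [|V GV] := rSL i (A := mx2 1 0 1 1); first by rewrite det_mx2; ring.
rewrite (Fp_mx_nat hl 1 0 1 1) => rV.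
split; first exact: rcenter_normal.
  apply/negP=> /fintype.subsetP/(_ U GU).
  by rewrite mem_rcenter // rU scalar_conj // (negPf transvection_nonscalar).
move=> M nM; have [|GM] := normal_scalar_or_full hl perfG nM l5 (Ug i) GU GV rU rV.
  by left.
right; apply: (fintype.subset_trans GM).
have sNG := normal_sub (rcenter_normal (r i)).
rewrite (normC (fintype.subset_trans sNG (normal_norm nM))).
apply: mulgS; apply/fintype.subsetP=> x /rkerP[Gx rx].
by rewrite mem_rcenter // rx scalar_mx_is_scalar.
Qed.

(** A representative of the class of the indices with the same [N]: for two
    such indices, the elements chosen for one of them serve for both. *)
Let c i := odflt i [pick j | N j == N i].

Lemma rcenter_class i : N (c i) = N i.
Proof. by rewrite /c; case: pickP => [j /eqP|]. Qed.

Lemma rcenter_chinese (X : I -> gT) : (forall i, X i \in G) ->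
  exists2 x, x \in G & forall i, coset (N i) x = coset (N i) (X (c i)).
Proof.
move=> GX; pose f H := if [pick j | N j == H] is Some j then X j else 1%g.
have fG H : f H \in G by rewrite /f; case: pickP.
have [|x Gx xP] := comaximal_chinese perfG (undup_uniq (codom N)) _ fG.
  by move=> H; rewrite mem_undup => /codomP[i ->]; apply: rcenter_comaximal.
have sG i := fintype.subsetP (normal_norm (rcenter_normal (r i))).
exists x => // i; apply/rcoset_kercosetP; rewrite ?sG //.
have := xP (N i); rewrite mem_undup codom_f => /(_ isT).
rewrite /f /c; case: pickP => [//|/(_ i)]; by rewrite eqxx.
Qed.

(** Lift the standard pair for the representative of each class of indices.
    The relations required by [psl2_pair_standard] say which words in the pair
    act by scalars, so they pass to all indices of the class. *)
Lemma lift_standard_pair :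
  exists h : I -> 'M[F]_2, exists U W, [/\ U \in G, W \in G
    & forall i, h i \in unitmx /\ exists e d : F,
      [/\ e ^+ 2 = 1, d ^+ 2 = 1,
        r i U = e *: (h i *m transvection 1 *m invmx (h i))
      & r i W = d *: (h i *m weyl F *m invmx (h i))]].
Proof.
have /fin_all_exists2[U0 GU0 rU0] i : exists2 x, x \in G &
    r i x = g i *m transvection 1 *m invmx (g i).
  by rewrite -(Fp_mx_transvection hl); apply: rSL; rewrite det_mx2; ring.
have /fin_all_exists2[W0 GW0 rW0] i : exists2 x, x \in G &
    r i x = g i *m weyl F *m invmx (g i).
  by rewrite -(Fp_mx_weyl hl); apply: rSL; rewrite det_mx2; ring.
have [U GU cU] := rcenter_chinese GU0; have [W GW cW] := rcenter_chinese GW0.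
have sG i := fintype.subsetP (normal_norm (rcenter_normal (r i))).
have memN i z : z \in G -> (z \in N i) = (coset (N i) z == 1%g).
  move=> Gz; apply/idP/eqP => [/coset_id //|]; exact: coset_idr (sG i z Gz).
suff /fin_all_exists2[h Uh hP] i : exists2 h, h \in unitmx &
    exists e d : F, [/\ e ^+ 2 = 1, d ^+ 2 = 1,
        r i U = e *: (h *m transvection 1 *m invmx h)
      & r i W = d *: (h *m weyl F *m invmx h)].
  by exists h, U, W; split.
have Nj := rcenter_class i; set j := c i in Nj.
have [GUj GWj] := (GU0 j, GW0 j).
have transfer z z' : z \in G -> z' \in G -> coset (N i) z = coset (N i) z' ->
    is_scalar_mx (r i z) = is_scalar_mx (r j z').
  by move=> Gz Gz' e; rewrite -!mem_rcenter // Nj !memN // e.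
have rWU : r j (W0 j * U0 j)%g = g j *m (weyl F *m transvection 1) *m invmx (g j).
  by rewrite repr_mxM // rU0 rW0 conjM.
apply: (psl2_pair_standard hl); rewrite ?perfect_det1 //.
- rewrite -repr_mxX // (@transfer _ (U0 j ^+ l)%g) ?groupX //.
    rewrite (repr_conj_exp l (Ug j) GUj (rU0 j)) scalar_conj // transvection_exp.
    by rewrite is_scalar_mx2 (pcharf0 hl) !eqxx.
  by rewrite !morphX ?sG //= cU.
- rewrite -repr_mxX // (@transfer _ (W0 j ^+ 2)%g) ?groupX //.
    rewrite (repr_conj_exp 2 (Ug j) GWj (rW0 j)) scalar_conj // expr2.
    rewrite [weyl F * _]mulmx2 is_scalar_mx2.
    by rewrite !mul0r !mulr0 !addr0 add0r mulr1 mul1r !eqxx.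
  by rewrite !morphX ?sG //= cW.
- rewrite -repr_mxM // -repr_mxX ?groupM //.
  rewrite (@transfer _ ((W0 j * U0 j) ^+ 3)%g) ?groupX ?groupM //.
    rewrite (repr_conj_exp 3 (Ug j) _ rWU) ?groupM // scalar_conj // exprS expr2.
    rewrite mulmx2 [mx2 _ _ _ _ * mx2 _ _ _ _]mulmx2 [mx2 _ _ _ _ * mx2 _ _ _ _]mulmx2.
    rewrite is_scalar_mx2; apply/and3P; split; apply/eqP; ring.
  by rewrite !morphX ?sG ?groupM //= !morphM ?sG //= cU cW.
- rewrite (@transfer _ (W0 j)) //.
  by rewrite rW0 scalar_conj // weyl_nonscalar.
rewrite -repr_mxM // (@transfer _ (W0 j * U0 j)%g) ?groupM //.
  by rewrite rWU scalar_conj // mulmx2 is_scalar_mx2 !mul0r !mul1r !add0r oner_eq0.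
by rewrite !morphM ?sG //= cU cW.
Qed.

(** A word in the standard generators that gives [A], evaluated at the lifted
    pair, gives [A] up to a sign and a conjugation for each index; squaring
    removes the sign. *)
Lemma perfect_simultaneous (A : 'M['F_l]_2) : \det A = 1 ->
  exists2 x, x \in G &
    forall i, conjugate (r i x *m r i x) (Fp_mx F (A *m A)).
Proof.
move=> dA; have pr_l := pcharf_prime hl.
have [h [U [W [GU GW hP]]]] := lift_standard_pair.
pose P (B : 'M['F_l]_2) := exists2 x, x \in G &
  forall i, exists2 e : F, e ^+ 2 = 1 & r i x = e *: (h i *m Fp_mx F B *m invmx (h i)).
have [x Gx xP] : P A.
  apply: SL2_generation dA; first exact: Fp_natr (pchar_Fp pr_l).
  - move=> B C [x Gx xP] [y Gy yP]; exists (x * y)%g; first exact: groupM.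
    move=> i; have [[e e2 rx] [d d2 ry]] := (xP i, yP i); have [Uh _] := hP i.
    exists (e * d); first by rewrite exprMn e2 d2 mulr1.
    by rewrite repr_mxM // rx ry -scalemxAl -scalemxAr scalerA conjM // Fp_mxM.
  - exists U => // i; have [_ [e [d [e2 _ rU _]]]] := hP i.
    by exists e; rewrite // Fp_mx_transvection.
  - exists W => // i; have [_ [e [d [_ d2 _ rW]]]] := hP i.
    by exists d; rewrite // Fp_mx_weyl.
exists x => // i; have [e e2 rx] := xP i; have [Uh _] := hP i.
exists (h i) => //.
by rewrite rx -scalemxAl -scalemxAr scalerA -expr2 e2 scale1r conjM // Fp_mxM.
Qed.

End Perfect.

Theorem simultaneous_squares (G : {group gT}) (r : I -> mx_representation F G 2) :
  (forall i (A : 'M['F_l]_2), \det A = 1 ->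
    exists2 x, x \in G & r i x = g i *m Fp_mx F A *m invmx (g i)) ->
  forall A : 'M['F_l]_2, \det A = 1 ->
  exists2 x, x \in G^`(1)%g &
    forall i, conjugate (r i x *m r i x) (Fp_mx F (A *m A)).
Proof.
move=> rSL A dA; have [H [sHG perfH HSL]] := perfect_subgroup_SL2 rSL.
have [x Hx xP] := @perfect_simultaneous H (fun i => subg_repr (r i) sHG) perfH HSL A dA.
by exists x => //; apply: (fintype.subsetP (dergS 1 sHG)); rewrite perfH.
Qed.

End SimultaneousImage.
(** * Finite quotients of the Galois group *)

Lemma GQ_eqP (s t : GQ) : s =1 t -> s = t.
Proof.
case: s => s [[s1] [s2]]; case: t => t [[t1] [t2]] /= e.
have {}e : s = t by apply/funext.
subst t; by rewrite (Prop_irrelevance s1 t1) (Prop_irrelevance s2 t2).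
Qed.

Lemma root_minCpoly_aut (s : GQ) (x z : algC) :
  root (minCpoly x) z -> root (minCpoly x) (s z).
Proof.
have [q [Dq _] _] := minCpolyP x; rewrite Dq -(fmorph_root s).
by rewrite -map_poly_comp (eq_map_poly (fmorph_rat s)).
Qed.

(** The quotient is the group of permutations induced on the set of conjugates
    of the members of [S].  The inverse in [pi] compensates for the product of
    permutations being opposite to the composition of functions. *)
Lemma finite_galois_quotient (S : seq algC) :
  exists (gT : finGroupType) (G : {group gT}) (pi : GQ -> gT),
  [/\ forall s, pi s \in G, forall x, x \in G -> exists s, pi s = x,
      forall s t : GQ, pi (s \o t) = (pi s * pi t)%g
    & forall s t, pi s = pi t -> {in S, s =1 t}].
Proof.
pose T := flatten [seq sval (closed_field_poly_normal (minCpoly x)) | x <- S].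
have memT z : reflect (exists2 x, x \in S & root (minCpoly x) z) (z \in T).
  have rootE x : root (minCpoly x) z =
      (z \in sval (closed_field_poly_normal (minCpoly x))).
    case: closed_field_poly_normal => t /= {1}->.
    by rewrite (monicP (minCpoly_monic x)) scale1r root_prod_XsubC.
  apply: (iffP flattenP) => [[_ /mapP[x Sx ->] zx]|[x Sx zx]].
    by exists x; rewrite ?rootE.
  by exists (sval (closed_field_poly_normal (minCpoly x))); rewrite -?rootE ?map_f.
have stab (s : GQ) (z : seq_sub T) : s (ssval z) \in T.
  have /memT[x Sx zx] := ssvalP z.
  by apply/memT; exists x => //; apply: root_minCpoly_aut.
pose act s z := SeqSub (stab s z).
have act_inj s : injective (act s).
  by move=> y z /(congr1 val)/fmorph_inj/val_inj.
pose pi s := ((perm (@act_inj s))^-1)%g.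
have piM (s t : GQ) : pi (s \o t) = (pi s * pi t)%g.
  rewrite /pi -invMg; congr _^-1%g; apply/permP=> z.
  by rewrite permM !permE; apply/val_inj.
have gG : group_set [set x | `[< exists s, pi s = x >]]%SET.
  apply/group_setP; split.
    rewrite inE; apply/asboolP; exists idfun; rewrite /pi.
    apply/eqP; rewrite eq_invg1; apply/eqP/permP=> z.
    by rewrite permE perm1; apply/val_inj.
  move=> _ _ /[!inE] /asboolP[s <-] /asboolP[t <-].
  by apply/asboolP; exists (s \o t : GQ).
exists {perm seq_sub T}, (group gG), pi; split=> //.
- by move=> s; rewrite inE; apply/asboolP; exists s.
- by move=> x /[!inE] /asboolP.
move=> s t /invg_inj/permP e x Sx.
have Tx : x \in T by apply/memT; exists x => //; apply: root_minCpoly.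
by have := congr1 val (e (SeqSub Tx)); rewrite !permE.
Qed.

Lemma aut_comm_root_unity (l : nat) (zeta : algC) (s t : GQ) :
  l.-primitive_root zeta -> s (t zeta) = t (s zeta).
Proof.
move=> hz; have power (u : GQ) : exists i, u zeta = zeta ^+ i.
  have [|i e] := prim_rootP hz (x := u zeta); last by exists i.
  by rewrite -rmorphXn (prim_expr_order hz) rmorph1.
have [[i ei] [j ej]] := (power s, power t).
by rewrite ej ei !rmorphXn /= ei ej -!exprM mulnC.
Qed.

(** * Reduction of an l-adic representation *)

Section Reduction.
Variables (R : realType) (l : nat) (Ql : fieldType) (K : closedFieldType).
Variables (inc : {rmorphism Ql -> K}) (av : K -> R).
Hypotheses (hl : prime l) (hK : padic_closure l inc av).
Variables (F : closedFieldType) (red : K -> F).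
Hypothesis hF : residue_field av red.

Let av_pos x : 0 <= av x := av_ge0 hK x.
Let av_mul x y : av (x * y) = av x * av y := avM hK x y.

Lemma av1 : av 1 = 1.
Proof.
have a0 : av 1 != 0 by rewrite (av_eq0 hK) oner_eq0.
by apply: (mulfI a0); rewrite -av_mul !mulr1.
Qed.

Lemma av_add_le x y c : av x <= c -> av y <= c -> av (x + y) <= c.
Proof. by move=> xc yc; apply: (le_trans (avD hK x y)); rewrite ge_max xc yc. Qed.

Lemma av_add_lt x y c : av x < c -> av y < c -> av (x + y) < c.
Proof. by move=> xc yc; apply: (le_lt_trans (avD hK x y)); rewrite gt_max xc yc. Qed.

Lemma av_mul_le1 x y : av x <= 1 -> av y <= 1 -> av (x * y) <= 1.
Proof. by move=> x1 y1; rewrite av_mul mulr_ile1. Qed.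

Lemma red0 : red 0 = 0.
Proof.
have a0 : av 0 = 0 by apply/eqP; rewrite (av_eq0 hK).
by apply/eqP; rewrite (red_eq0 hF) a0 ?ler01 ?ltr01.
Qed.

Lemma red_nat n : av n%:R <= 1 /\ red n%:R = n%:R.
Proof.
elim: n => [|n [an rn]].
  have a0 : av 0 = 0 by apply/eqP; rewrite (av_eq0 hK).
  by rewrite a0 ler01 red0.
split; first by rewrite -natr1; apply: av_add_le; rewrite ?av1.
by rewrite -[in LHS]natr1 (redD hF) ?av1 // (red1 hF) rn natr1.
Qed.

Lemma residue_pchar : l \in [pchar F].
Proof.
rewrite inE hl /=; have [al <-] := red_nat l.
rewrite (red_eq0 hF) // (av_l hK) invf_lt1 ?ltr1n ?prime_gt1 //.
by rewrite ltr0n prime_gt0.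
Qed.

Lemma red_eq1 x : av (x - 1) < 1 -> red x = 1.
Proof.
move=> x1; have x1' := ltW x1.
rewrite -[x](subrK 1) (redD hF) ?av1 // (red1 hF).
have /eqP-> : red (x - 1) == 0 by rewrite (red_eq0 hF).
by rewrite add0r.
Qed.

Lemma red_small x : av x < 1 -> red x = 0.
Proof. by move=> x1; apply/eqP; rewrite (red_eq0 hF) ?ltW. Qed.

Definition integral_mx (A : 'M[K]_2) := forall i j, av (A i j) <= 1.

Lemma map_redM (A B : 'M[K]_2) : integral_mx A -> integral_mx B ->
  map_mx red (A *m B) = map_mx red A *m map_mx red B.
Proof.
move=> iA iB; apply/matrixP=> i j; rewrite !mxE !sum_ord2 !mxE.
by rewrite (redD hF) ?av_mul_le1 // !(redM hF).
Qed.

Lemma map_red_near1 (A : 'M[K]_2) :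
  (forall i j, av ((A - 1%:M) i j) < 1) -> map_mx red A = 1%:M.
Proof.
move=> A1; apply/matrixP=> i j; rewrite !mxE; have := A1 i j; rewrite !mxE.
by case: eqP => _; [apply: red_eq1 | rewrite subr0; apply: red_small].
Qed.

Lemma conj_near1 (g : 'M[K]_2) : g \in unitmx -> exists2 e : R, 0 < e &
  forall A : 'M[K]_2, (forall i j, av ((A - 1%:M) i j) < e) ->
    forall i j, av ((g *m A *m invmx g - 1%:M) i j) < 1.
Proof.
move=> Ug; have bound (B : 'M[K]_2) : exists2 c, 0 < c & forall i j, av (B i j) <= c.
  exists (1 + (av (B 0 0) + av (B 0 1) + (av (B 1 0) + av (B 1 1)))).
    by rewrite ltr_pwDl ?ltr01 // !addr_ge0.
  by apply: ord2_ind; apply: ord2_ind;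
    have := (av_pos (B 0 0), av_pos (B 0 1), av_pos (B 1 0), av_pos (B 1 1));
    move=> [[[]]]; lra.
have [c c0 gc] := bound g; have [d d0 gd] := bound (invmx g).
exists (c^-1 * d^-1); first by rewrite mulr_gt0 ?invr_gt0.
move=> A A1 i j.
have -> : g *m A *m invmx g - 1%:M = g *m (A - 1%:M) *m invmx g.
  by rewrite mulmxBr mulmxBl mulmx1 mulmxV.
have mul_lt (x y : K) (a b : R) : 0 < a -> av x <= a -> av y < b -> av (x * y) < a * b.
  move=> a0 xa yb; rewrite av_mul; apply: (le_lt_trans (y := a * av y)).
    by rewrite ler_wpM2r.
  by rewrite ltr_pM2l.
have step i' j' : av ((g *m (A - 1%:M)) i' j') < d^-1.
  rewrite mxE sum_ord2; have -> : d^-1 = c * (c^-1 * d^-1) by rewrite mulVKf ?gt_eqF.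
  by apply: av_add_lt; apply: mul_lt.
rewrite mxE sum_ord2; have -> : 1 = d * d^-1 by rewrite divff ?gt_eqF.
by apply: av_add_lt; rewrite mulrC; apply: mul_lt.
Qed.

Section OneForm.
Variables (rho : GQ -> 'M[K]_2) (rhobar : GQ -> 'M[F]_2).
Hypotheses (rho_rep : representation rho) (rho_cont : continuous_rep av rho).
Hypotheses (hss : ss_reduction av red rho rhobar).
Hypothesis hSL2 : contains_conj_SL2 l rhobar.

(** A reducible semisimple representation has commutative image, and SL2 is
    not commutative. *)
Lemma ss_reduction_conj : exists g h,
  [/\ g \in unitmx, h \in unitmx,
      forall s, integral_mx (g *m rho s *m invmx g)
    & forall s, rhobar s = h *m map_mx red (g *m rho s *m invmx g) *m invmx h].
Proof.
have [g [Ug ig [[_ [h Uh hE]]|[h1 [h [chi1 [chi2 [b [_ Uh _ hE]]]]]]]]] := hss.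
  by exists g, h.
have [g0 Ug0 SL2] := hSL2.
have [|s su] := SL2 (transvection 1); first by rewrite det_mx2; ring.
have [|t tw] := SL2 (weyl _); first by rewrite det_mx2; ring.
have comm : rhobar s *m rhobar t = rhobar t *m rhobar s.
  rewrite !hE !conjM //; congr (_ *m _ *m _).
  apply: matrix2P; rewrite !mxE !sum_ord2 !mxE /=; ring.
move: comm; rewrite su tw !conjM // => /(conj_inj Ug0).
rewrite (Fp_mx_transvection residue_pchar) (Fp_mx_weyl residue_pchar) !mulmx2.
case/mx2_inj=> /eqP; rewrite !mul1r !mulr0 !mul0r !add0r.
by rewrite oppr_eq0 oner_eq0.
Qed.

Lemma rhobar_representation : representation rhobar.
Proof.
have [g [h [Ug Uh ig hE]]] := ss_reduction_conj; have [r1 rM] := rho_rep.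
split=> [|s t]; last first.
  by rewrite !hE (conjM _ _ Uh) rM -(conjM _ _ Ug) map_redM.
rewrite hE r1 mulmx1 mulmxV // map_red_near1 ?mulmx1 ?mulmxV // => i j.
rewrite subrr mxE (_ : av 0 = 0) ?ltr01 //.
by apply/eqP; rewrite (av_eq0 hK).
Qed.

(** By continuity, an automorphism that fixes some finite set [S] has an image
    close to the identity, which reduces to the identity. *)
Lemma rhobar_finite : exists S : seq algC,
  forall s t : GQ, {in S, s =1 t} -> rhobar s = rhobar t.
Proof.
have [g [h [Ug Uh ig hE]]] := ss_reduction_conj; have [r1 rM] := rho_rep.
have [e e0 near1] := conj_near1 Ug.
have [S hS] := rho_cont idfun e0; exists S => s t st.
pose u : GQ := algC_invaut t \o s.
have su : rho s = rho t *m rho u.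
  by rewrite -rM; congr rho; apply: GQ_eqP => x /=; rewrite algC_invautK.
have rhou : map_mx red (g *m rho u *m invmx g) = 1%:M.
  apply: map_red_near1; apply: near1 => i j.
  have := hS u _ i j; rewrite r1 !mxE; apply=> x Sx /=.
  by rewrite st // algC_autK.
have := hE s; rewrite su -(conjM _ _ Ug) map_redM // rhou mulmx1 => ->.
by rewrite hE.
Qed.

End OneForm.
End Reduction.
(** * Conclusion *)

Theorem proposition1p3
  (R : realType) (iota : {rmorphism algC -> Cplx R})
  (l : nat) (hl : prime l) (hl5 : (5 <= l)%N)
  (Ql : fieldType) (K : closedFieldType) (inc : {rmorphism Ql -> K})
  (av : K -> R) (hK : padic_closure l inc av)
  (F : closedFieldType) (red : K -> F) (hF : residue_field av red)
  (iotal : {rmorphism algC -> K})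
  (zeta : algC) (hzeta : l.-primitive_root zeta)
  (k : nat) (hk : (0 < k)%N) (hk_even : ~~ odd k)
  (N : nat) (hN : (0 < N)%N) (hlN : ~~ (l %| N)%N)
  (psi : int -> algC) (hpsi : dirichlet_character N psi)
  (s : nat) (f : 'I_s -> Cplx R -> Cplx R) (a : 'I_s -> nat -> algC)
  (hf : forall i, integral_cusp_form iota l k N psi (f i) (a i))
  (hfe : forall i, normalized_eigenform k N psi (a i))
  (rho : 'I_s -> GQ -> 'M[K]_2)
  (hrho : forall i, attached_rep av iotal l k N psi (a i) (rho i))
  (rhobar : 'I_s -> GQ -> 'M[F]_2)
  (hrhobar : forall i, ss_reduction av red (rho i) (rhobar i))
  (himage : forall i, contains_conj_SL2 l (rhobar i)) :
  forall gamma : 'M['F_l]_2, \det gamma = 1 ->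
  exists sigma : GQ, sigma zeta = zeta /\
    forall i, conjugate (rhobar i (sigma \o sigma)) (Fp_mx F (gamma *m gamma)).
Proof.
move=> gamma dgamma.
have rb_rep i : representation (rhobar i).
  have [r_rep r_cont _ _ _] := hrho i.
  exact: (rhobar_representation hl hK hF r_rep (hrhobar i) (himage i)).
have /fin_all_exists[S hS] i : exists T : seq algC,
    forall t u : GQ, {in T, t =1 u} -> rhobar i t = rhobar i u.
  have [r_rep r_cont _ _ _] := hrho i.
  exact: (rhobar_finite hl hK hF r_rep r_cont (hrhobar i) (himage i)).
pose T := zeta :: flatten (codom S).
have [gT [G [pi [Gpi surj piM piT]]]] := finite_galois_quotient T.
have pi_rhobar i t u : pi t = pi u -> rhobar i t = rhobar i u.
  move/piT=> e; apply: hS => x Sx; apply: e.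
  by rewrite inE; apply/orP; right; apply/flattenP; exists (S i); rewrite ?codom_f.
have pi_zeta t u : pi t = pi u -> t zeta = u zeta.
  by move/piT; apply; apply: mem_head.
have pi1 : pi idfun = 1%g.
  by apply: (mulgI (pi idfun)); rewrite -piM mulg1; congr pi; apply: GQ_eqP.
have /fin_all_exists[lift liftP] x : exists t : GQ, x \in G -> pi t = x.
  by have [Gx|_] := boolP (x \in G); [have [t] := surj x Gx; exists t | exists idfun].
have r_repr i : mx_repr G (fun x => rhobar i (lift x)).
  have [rb1 rbM] := rb_rep i; split=> [|x y Gx Gy].
    by rewrite -rb1; apply: pi_rhobar; rewrite liftP ?pi1.
  by rewrite -rbM; apply: pi_rhobar; rewrite piM !liftP ?groupM.
have /fin_all_exists2[g Ug hg] := himage.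
have [|x G'x xP] := simultaneous_squares (residue_pchar hl hK hF) hl5 Ug
  (r := fun i => MxRepresentation (r_repr i)) _ dgamma.
  move=> i A dA; have [t rt] := hg i A dA.
  exists (pi t) => //=; rewrite -rt; apply: pi_rhobar; exact: liftP.
(* Galois automorphisms commute on roots of unity, so commutators fix
   [zeta]. *)
have fix_zeta : forall t, pi t = x -> t zeta = zeta.
  move: x G'x {xP}; apply: der1_ind.
  - by move=> t; rewrite -pi1 => /pi_zeta.
  - move=> x y Gx Gy fx fy t tE.
    rewrite (@pi_zeta t (lift x \o lift y : GQ)) /=; last by rewrite piM !liftP.
    by rewrite fy ?fx ?liftP.
  move=> x y Gx Gy t tE.
  have /pi_zeta /= : pi (lift y \o (lift x \o t : GQ) : GQ) = pi (lift x \o lift y : GQ).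
    by rewrite !piM tE !liftP // commgEl conjgE !mulgA mulgK mulgV mul1g.
  by rewrite -(aut_comm_root_unity (lift y) (lift x) hzeta) => /fmorph_inj/fmorph_inj.
have Gx : x \in G by apply: (fintype.subsetP (der_sub 1 G)).
exists (lift x); split; first by apply: fix_zeta; apply: liftP.
by move=> i; have [_ rbM] := rb_rep i; rewrite rbM; apply: xP.
Qed.
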